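(* Let $m\ge2$ be an integer, $w$ an infinite Sturmian or periodic word over $\{0,1\}$, and $A=A(m,w)=A_0\oplus A_1$ with the $\mathbb{Z}_2$-grading in which $z_1^{(1)},a$ are even and $b$ is odd. Let $A^\#$ be obtained from $A$ by adjoining an external unit, with the induced grading. Then $\exp^{gr}(A^\#)$ exists and $\exp^{gr}(A^\#)=1+\exp^{gr}(A)$.
   Context: $F$ is a field of characteristic zero. $A(m,w)$: basis $\{a,b,z_j^{(i)}: i\ge1,1\le j\le m+w_i\}$, products $z_j^{(i)}a=z_{j+1}^{(i)}$ for $j<m+w_i$, $z_{m+w_i}^{(i)}b=z_1^{(i+1)}$, all other products of basis elements zero. The stated grading is $A_0=\mathrm{span}\{a,z_j^{(i)}:i\text{ odd}\}$, $A_1=\mathrm{span}\{b,z_j^{(i)}:i\text{ even}\}$. A word is Sturmian if it has exactly $n+1$ distinct subwords of length $n$ for every $n\ge1$. $A^\#=A\oplus F1$ with $1$ a two-sided unit; its induced grading is $A^\#_0=A_0\oplus F1$, $A^\#_1=A_1$. Graded codimensions: in the free nonassociative algebra $F\{X,Y\}$ with even generators $X$ and odd generators $Y$, graded identities are polynomials vanishing under all degree-respecting substitutions; $c_{k,n-k}(B)=\dim P_{k,n-k}/(P_{k,n-k}\cap Id^{gr}(B))$ with $P_{k,n-k}$ the polynomials multilinear in $x_1..x_k\in X$, $y_1..y_{n-k}\in Y$; $c^{gr}_n(B)=\sum_k\binom nk c_{k,n-k}(B)$; $\exp^{gr}(B)=\lim\sqrt[n]{c_n^{gr}(B)}$ when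 it exists. *)

(* Defs.v *)
From HB Require Import structures.
From mathcomp Require Import all_boot all_order all_algebra.
From Stdlib Require Import ClassicalEpsilon.
From Stdlib Require Import Reals.

Set Implicit Arguments.
Unset Strict Implicit.
Unset Printing Implicit Defensive.

Import GRing.Theory.

Record galg (F : Type) := GAlg {
  gcar   : Type;
  gzero  : gcar;
  gadd   : gcar -> gcar -> gcar;
  gscale : F -> gcar -> gcar;
  gmul   : gcar -> gcar -> gcar;
  geven  : gcar -> Prop;
  godd   : gcar -> Prop
}.

(* The free nonassociative algebra F{X,Y}.                             *)
(* Variables: inl i = x_i (even), inr i = y_i (odd).                   *)
(* Nonassociative monomials are binary trees with variable leaves;     *)
(* they form a basis of F{X,Y}; a polynomial is a finite F-linear      *)
(* combination of monomials (list of (coefficient, monomial)).         *)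
Definition gvar := (nat + nat)%type.

Inductive nmon := MVar of gvar | MMul of nmon & nmon.

Fixpoint leaves (u : nmon) : seq gvar :=
  match u with MVar v => [:: v] | MMul u1 u2 => leaves u1 ++ leaves u2 end.

Definition npoly (F : Type) := seq (F * nmon).

Definition mvars (k l : nat) : seq gvar :=
  [seq inl i | i <- iota 1 k] ++ [seq inr i | i <- iota 1 l].

Definition in_P (F : Type) (k l : nat) (f : npoly F) : Prop :=
  forall p, List.In p f -> perm_eq (leaves p.2) (mvars k l).

Section Eval.
Variables (F : Type) (B : galg F).

Definition subst := gvar -> gcar B.

Fixpoint mon_eval (s : subst) (u : nmon) : gcar B :=
  match u with
  | MVar v => s v
  | MMul u1 u2 => @gmul F B (mon_eval s u1) (mon_eval s u2)
  end.

Definition poly_eval (s : subst) (f : npoly F) : gcar B :=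
  foldr (fun p acc => @gadd F B (@gscale F B p.1 (mon_eval s p.2)) acc) (gzero B) f.

Definition graded_subst (s : subst) : Prop :=
  (forall i, @geven F B (s (inl i))) /\ (forall i, @godd F B (s (inr i))).

Definition is_gr_identity (f : npoly F) : Prop :=
  forall s, graded_subst s -> poly_eval s f = gzero B.
End Eval.

Section Codim.
Variables (F : fieldType) (B : galg F).
Local Open Scope ring_scope.

Definition lincomb (cs : seq F) (fs : seq (npoly F)) : npoly F :=
  flatten [seq [seq (cf.1 * p.1, p.2) | p <- cf.2] | cf <- zip cs fs].

Definition indep_mod_Id (k l : nat) (fs : seq (npoly F)) : Prop :=
  (forall f, List.In f fs -> in_P k l f) /\
  forall cs : seq F, size cs = size fs -> has (fun c => c != 0) cs ->
    ~ is_gr_identity B (lincomb cs fs).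

(* d = dim P_{k,l} / (P_{k,l} ∩ Id^gr(B)) *)
Definition is_codim (k l : nat) (d : nat) : Prop :=
  (exists fs, size fs = d /\ indep_mod_Id k l fs) /\
  (forall fs, indep_mod_Id k l fs -> leq (size fs) d).

Definition codim (k l : nat) : nat :=
  epsilon (inhabits 0%nat) (is_codim k l).

Definition gr_codim (n : nat) : nat :=
  (\sum_(k < n.+1) 'C(n, k) * codim k (n - k))%nat.
End Codim.

Definition nroot (n : nat) (x : R) : R :=
  if Req_EM_T x R0 then R0 else Rpower x (/ INR n).

Definition gr_exp_is (F : fieldType) (B : galg F) (L : R) : Prop :=
  Un_cv (fun n => nroot n (INR (gr_codim B n))) L.

(* An infinite word w = w_1 w_2 ... over {0,1} is w : nat -> bool with  *)
(* w_i = w i for i >= 1 (w 0 is irrelevant); letter 1 = true.          *)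
Definition subword (w : nat -> bool) (i n : nat) : seq bool :=
  [seq w (i + t)%nat | t <- iota 0 n].

Definition is_subword (w : nat -> bool) (n : nat) (u : seq bool) : Prop :=
  exists2 i, (1 <= i)%nat & u = subword w i n.

Definition sturmian (w : nat -> bool) : Prop :=
  forall n, (1 <= n)%nat -> exists s : seq (seq bool),
    [/\ uniq s, size s = n.+1 & forall u, u \in s <-> is_subword w n u].

Definition periodic_word (w : nat -> bool) : Prop :=
  exists2 p, (0 < p)%nat & forall i, (1 <= i)%nat -> w (i + p)%nat = w i.

(* Basis symbols: a, b, z_j^{(i)} (i >= 1, 1 <= j <= m + w_i).         *)
(* Vectors are represented as coefficient functions on the symbols;    *)
(* elements of A are those with finite support on genuine basis        *)
(* symbols. The product is defined coefficientwise (each coefficient   *)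
(* of a product is a single product of coefficients), which restricts  *)
(* on basis elements to the multiplication table of A(m,w).            *)
Inductive sym := Sa | Sb | Sz of nat & nat.   (* Sz i j = z_j^{(i)} *)

Section Amw.
Variables (F : fieldType) (m : nat) (w : nat -> bool).
Local Open Scope ring_scope.

Definition len (i : nat) : nat := (m + w i)%nat.

Definition valid_sym (s : sym) : bool :=
  match s with
  | Sz i j => (1 <= i)%nat && (1 <= j <= len i)%nat
  | _ => true
  end.

Definition vecA := sym -> F.

Definition inA (u : vecA) : Prop :=
  (forall s, u s != 0 -> valid_sym s) /\
  (exists N, forall i j, (N <= i)%nat -> u (Sz i j) = 0).

Definition vzero : vecA := fun _ => 0.
Definition vadd (u v : vecA) : vecA := fun s => u s + v s.
Definition vscale (c : F) (u : vecA) : vecA := fun s => c * u s.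

(* z_j^{(i)} a = z_{j+1}^{(i)} (j < m+w_i);  z_{m+w_i}^{(i)} b = z_1^{(i+1)} *)
Definition vmul (u v : vecA) : vecA := fun s =>
  match s with
  | Sz i j =>
      if (1 <= i)%nat && (2 <= j <= len i)%nat then u (Sz i j.-1) * v Sa
      else if (2 <= i)%nat && (j == 1)%nat then u (Sz i.-1 (len i.-1)) * v Sb
      else 0
  | _ => 0
  end.

(* A_0 = span{a, z_j^{(i)} : i odd},  A_1 = span{b, z_j^{(i)} : i even} *)
Definition evenA (u : vecA) : Prop :=
  inA u /\ u Sb = 0 /\ forall i j, ~~ odd i -> u (Sz i j) = 0.
Definition oddA (u : vecA) : Prop :=
  inA u /\ u Sa = 0 /\ forall i j, odd i -> u (Sz i j) = 0.

Definition Amw : galg F := GAlg vzero vadd vscale vmul evenA oddA.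

(* A^# = A ⊕ F1 ; elements (alpha, u) = alpha 1 + u *)
Definition vecAs := (F * vecA)%type.
Definition szero : vecAs := (0, vzero).
Definition sadd (p q : vecAs) : vecAs := (p.1 + q.1, vadd p.2 q.2).
Definition sscale (c : F) (p : vecAs) : vecAs := (c * p.1, vscale c p.2).
Definition smul (p q : vecAs) : vecAs :=
  (p.1 * q.1, vadd (vadd (vscale p.1 q.2) (vscale q.1 p.2)) (vmul p.2 q.2)).
Definition evenAs (p : vecAs) : Prop := evenA p.2.
Definition oddAs (p : vecAs) : Prop := p.1 = 0 /\ oddA p.2.

Definition Amw_unital : galg F := GAlg szero sadd sscale smul evenAs oddAs.
End Amw.

(* Main.v *)
(* Every product x (y z) vanishes in A, and right multiplication by a and b moves the z's
   along one infinite path, spelling a binary word W.  Hence P_{k,l} modulo the identities of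
   A is governed by the pairs (first variable, factor of W giving the parities of the other
   variables).  The number of factors of W of length n is polynomial in n, so c_n(A) is, up
   to polynomial factors, the binomial coefficient C(n, M(n)), where M(n) is the largest
   number of b's in a factor of length n: as m >= 2 we have M(n) <= (n + 1) / 2, where
   binomial coefficients increase.  M is subadditive, so M(n) / n tends to some beta by
   Fekete's lemma (no balance property of w is needed), and exp^gr(A) = exp(h(beta)) with h
   the binary entropy.

   In the unital algebra each even variable is replaced by 1 or by an element of A, so
   c_{k,l}(A^#) <= 1 + sum over subsets T of the even variables of the bound for A on T and
   the odd variables.  Conversely left-normed commutators vanish as soon as a variable is 1,
   so multiplying one nonzero commutator for each T by the even variables outside T gives
   independent polynomials.  Thus c_n(A^#) is, up to polynomial factors,
   sum_q C(n, q) C(q, M(q)), of growth rate 1 + exp(h(beta)). *)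

From Stdlib Require Import ClassicalEpsilon FunctionalExtensionality.
From Stdlib Require Import Reals Lra.
From mathcomp Require Import all_boot all_order all_algebra.
From mathcomp Require Import zify.
Require Import Defs.

Set Implicit Arguments.
Unset Strict Implicit.
Unset Printing Implicit Defensive.

Import GRing.Theory.

(** * Exponential growth rates *)

Section Growth.
Local Open Scope R_scope.

(** The slack [d] absorbs polynomial factors and [K] finitely many exceptional [n]; [r] is the
    logarithm of the growth rate. *)
Definition upper_rate (u : nat -> nat) (r : R) :=
  forall d, 0 < d -> exists2 K, 0 < K & forall n, INR (u n) <= K * exp (r + d) ^ n.

Definition lower_rate (u : nat -> nat) (r : R) :=
  forall d, 0 < d -> exists2 K, 0 < K & forall n, K * exp (r - d) ^ n <= INR (u n).

Lemma exp_pow x n : exp x ^ n = exp (INR n * x).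
Proof.
elim: n => [|n IH]; first by rewrite /= Rmult_0_l exp_0.
by rewrite /= IH -exp_plus -/(INR n.+1) S_INR; congr exp; ring.
Qed.

Lemma INR_leq a b : (a <= b)%N -> INR a <= INR b.
Proof. by move=> h; apply: le_INR; lia. Qed.

Lemma ln_le x y : 0 < x -> x <= y -> ln x <= ln y.
Proof.
move=> x0 [xy|->]; last by apply: Rle_refl.
by left; apply: ln_increasing.
Qed.

Lemma upper_rate_le u v r :
  (forall n, (u n <= v n)%N) -> upper_rate v r -> upper_rate u r.
Proof.
move=> uv hv d d0; have [K K0 hK] := hv d d0; exists K => // n.
by apply: Rle_trans (hK n); apply: INR_leq.
Qed.

(** Half of the slack pays for the linear factor, since [exp (n * d / 2)] is at least
    [1 + n * d / 2]. *)
Lemma upper_rate_S u r : upper_rate u r -> upper_rate (fun n => n.+1 * u n)%N r.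
Proof.
move=> hu d d0; have [K K0 hK] := hu (d / 2) ltac:(lra).
have c1 : 0 < 1 + 2 / d by apply: Rplus_lt_0_compat; [lra|apply: Rdiv_lt_0_compat; lra].
exists ((1 + 2 / d) * K); first by apply: Rmult_lt_0_compat.
move=> n; rewrite mult_INR.
have -> : r + d = d / 2 + (r + d / 2) by lra.
rewrite exp_plus Rpow_mult_distr.
have e1 : INR n.+1 <= (1 + 2 / d) * exp (d / 2) ^ n.
  rewrite exp_pow S_INR.
  have h := exp_ineq1_le (INR n * (d / 2)); have n0 := pos_INR n.
  have h2 : (1 + 2 / d) * (1 + INR n * (d / 2)) <= (1 + 2 / d) * exp (INR n * (d / 2)).
    by apply: Rmult_le_compat_l => //; lra.
  apply: Rle_trans h2.
  have -> : (1 + 2 / d) * (1 + INR n * (d / 2)) =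
    1 + INR n + 2 / d + INR n * (d / 2) by field; lra.
  have : 0 <= 2 / d by apply: Rlt_le; apply: Rdiv_lt_0_compat; lra.
  have : 0 <= INR n * (d / 2) by apply: Rmult_le_pos; lra.
  lra.
have -> : (1 + 2 / d) * K * (exp (d / 2) ^ n * exp (r + d / 2) ^ n) =
  ((1 + 2 / d) * exp (d / 2) ^ n) * (K * exp (r + d / 2) ^ n) by ring.
by apply: Rmult_le_compat => //; apply: pos_INR.
Qed.

Lemma upper_rate_mul c u r : upper_rate u r -> upper_rate (fun n => c * u n)%N r.
Proof.
move=> hu d d0; have [K K0 hK] := hu d d0; have c0 := pos_INR c.
exists ((INR c + 1) * K); first by apply: Rmult_lt_0_compat; lra.
move=> n; rewrite mult_INR Rmult_assoc.
by apply: Rmult_le_compat; (try apply: pos_INR) => //; lra.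
Qed.

Lemma rates_Un_cv u v r n1 : upper_rate u r -> lower_rate v r ->
  (forall n, (n1 <= n)%N -> (v n <= u n)%N) ->
  Un_cv (fun n => nroot n (INR (u n))) (exp r).
Proof.
move=> hu hl vu e e0.
have [d d0 hd] : exists2 d, 0 < d & forall x, r - d <= x <= r + d -> Rabs (exp x - exp r) < e.
  have := derivable_continuous_pt _ _ (derivable_pt_exp r).
  move=> /(_ e e0) [a [a0 ha]]; exists (a / 2); first lra.
  move=> x hx; have [->|xr] := Req_dec x r.
    by rewrite Rminus_diag Rabs_R0.
  apply: ha; split; first by split => //; apply: nesym.
  by rewrite /= /Rdist; apply: Rabs_def1; lra.
have [K K0 hK] := hu (d / 2) ltac:(lra).
have [M M0 hM] := hl (d / 2) ltac:(lra).
(* After taking logarithms and dividing by [n], the constants [K] and [M] contribute at most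
   [B / n], which is below [d / 2] for large [n]. *)
pose B := Rabs (ln K) + Rabs (ln M).
have [N hN] := INR_unbounded (B * 2 / d); exists (N.+1 + n1)%N => n nN; rewrite /Rdist /nroot.
have {}hM := Rle_trans _ _ _ (hM n) (INR_leq (vu n ltac:(lia))).
have n0 : 0 < INR n by apply: lt_0_INR; lia.
have nB : B <= INR n * (d / 2).
  have : B * 2 / d <= INR n.
    by apply: Rle_trans (Rlt_le _ _ hN) _; apply: INR_leq; lia.
  move=> h; have -> : B = (B * 2 / d) * (d / 2) by field; lra.
  by apply: Rmult_le_compat_r; lra.
have pos : 0 < INR (u n).
  by apply: Rlt_le_trans hM; apply: Rmult_lt_0_compat => //; apply/pow_lt/exp_pos.
destruct (Req_EM_T (INR (u n)) R0) as [u0|u1]; first by rewrite u0 in pos; lra.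
rewrite /Rpower; apply: hd.
have l1 := ln_le pos (hK n).
have l2 : ln (M * exp (r - d / 2) ^ n) <= ln (INR (u n)).
  by apply: ln_le => //; apply: Rmult_lt_0_compat => //; apply/pow_lt/exp_pos.
move: l1 l2; rewrite !ln_mult //; try exact/pow_lt/exp_pos.
rewrite !exp_pow !ln_exp => l1 l2.
have b1 := Rle_abs (ln K); have b2 := Rle_abs (- ln M).
rewrite Rabs_Ropp in b2; have b3 := Rabs_pos (ln K); have b4 := Rabs_pos (ln M).
have i0 : 0 < / INR n by apply: Rinv_0_lt_compat.
have E x : x = / INR n * (INR n * x) by field; lra.
rewrite /B in nB; rewrite (E (r - d)) (E (r + d)).
by split; apply: Rmult_le_compat_l; lra.
Qed.

Lemma sum_binS (B : nat -> nat) n :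
  (\sum_(q < n.+2) 'C(n.+1, q) * B q =
   \sum_(q < n.+1) 'C(n, q) * B q + \sum_(q < n.+1) 'C(n, q) * B q.+1)%N.
Proof.
rewrite big_ord_recl bin0 /=.
under eq_bigr => i _ do rewrite /bump /= add1n binS mulnDl.
rewrite big_split /= addnA; congr (_ + _)%N.
by rewrite [in RHS]big_ord_recl bin0 big_ord_recr /= bin_small // mul0n addn0.
Qed.

(** Pascal's rule splits the sum into those for [B] and for its shift; the shift obeys the bound
    with [K * y] for [K], so [B] and [K] vary in the induction. *)
Lemma sum_bin_le (B : nat -> nat) K y n : 0 <= y ->
  (forall q, INR (B q) <= K * y ^ q) ->
  INR (\sum_(q < n.+1) 'C(n, q) * B q)%N <= K * (1 + y) ^ n.
Proof.
move=> y0; elim: n B K => [|n IH] B K hB.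
  by rewrite big_ord1 bin0 mul1n; apply: Rle_trans (hB _) _; apply: Rle_refl.
rewrite sum_binS plus_INR.
have h1 := IH B K hB.
have h2 : INR (\sum_(q < n.+1) 'C(n, q) * B q.+1)%N <= K * y * (1 + y) ^ n.
  by apply: (IH (fun q => B q.+1)) => q; apply: Rle_trans (hB _) _; rewrite /= -Rmult_assoc; apply: Rle_refl.
by rewrite [(1 + y) ^ n.+1]/=; lra.
Qed.

Lemma sum_bin_ge (B : nat -> nat) K y n : 0 <= y ->
  (forall q, K * y ^ q <= INR (B q)) ->
  K * (1 + y) ^ n <= INR (\sum_(q < n.+1) 'C(n, q) * B q)%N.
Proof.
move=> y0; elim: n B K => [|n IH] B K hB.
  by rewrite big_ord1 bin0 mul1n; apply: Rle_trans (hB _); apply: Rle_refl.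
rewrite sum_binS plus_INR.
have h1 := IH B K hB.
have h2 : K * y * (1 + y) ^ n <= INR (\sum_(q < n.+1) 'C(n, q) * B q.+1)%N.
  by apply: (IH (fun q => B q.+1)) => q; apply: Rle_trans (hB _); rewrite /= -Rmult_assoc; apply: Rle_refl.
by rewrite [(1 + y) ^ n.+1]/=; lra.
Qed.

Lemma upper_rate_bin B r : upper_rate B r ->
  upper_rate (fun n => \sum_(q < n.+1) 'C(n, q) * B q)%N (ln (1 + exp r)).
Proof.
move=> hB d d0; have [K K0 hK] := hB d d0; exists K => // n.
have p := exp_pos r; have pd := exp_pos (r + d).
apply: Rle_trans (sum_bin_le n (Rlt_le _ _ pd) hK) _.
apply: Rmult_le_compat_l; first lra.
apply: pow_incr; split; first lra.
rewrite !exp_plus exp_ln; last lra.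
by have := exp_ineq1_le d; nra.
Qed.

(** The factor [n.+1] allows each summand to be bounded by [c n] separately. Half of the slack
    absorbs it; the other half goes into the rate of [B]. *)
Lemma lower_rate_bin B c r : lower_rate B r ->
  (forall n, (\sum_(q < n.+1) 'C(n, q) * B q <= n.+1 * c n)%N) ->
  lower_rate c (ln (1 + exp r)).
Proof.
move=> hB hc d d0; have [K K0 hK] := hB (d / 2) ltac:(lra).
have [M M0 hM] : exists2 M, 0 < M & forall n, INR n.+1 <= M * exp (d / 2) ^ n.
  have [|M M0 hM] := @upper_rate_S (fun=> 1%N) 0 _ (d / 2) ltac:(lra).
    move=> e e0; exists 1; first lra.
    by move=> n; rewrite Rmult_1_l Rplus_0_l; apply: pow_R1_Rle; have := exp_ineq1_le e; lra.
  by exists M => // n; have := hM n; rewrite muln1 Rplus_0_l.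
exists (K / M); first exact: Rdiv_lt_0_compat.
move=> n; have p := exp_pos r; have pd := exp_pos (r - d / 2); have p2 := exp_pos (d / 2).
have h := sum_bin_ge n (Rlt_le _ _ pd) hK.
have h1 := INR_leq (hc n); rewrite mult_INR in h1.
have h2 : INR n.+1 * INR (c n) <= M * exp (d / 2) ^ n * INR (c n).
  by apply: Rmult_le_compat_r => //; apply: pos_INR.
have X0 : 0 < M * exp (d / 2) ^ n by apply: Rmult_lt_0_compat => //; apply: pow_lt.
apply: (Rmult_le_reg_l _ _ _ X0); apply: Rle_trans (Rle_trans _ _ _ (Rle_trans _ _ _ h h1) h2).
have -> : M * exp (d / 2) ^ n * (K / M * exp (ln (1 + exp r) - d) ^ n) =
  K * (exp (d / 2) * exp (ln (1 + exp r) - d)) ^ n.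
  by rewrite Rpow_mult_distr; field; lra.
apply: Rmult_le_compat_l; first lra.
apply: pow_incr; split.
  by apply: Rlt_le; apply: Rmult_lt_0_compat => //; apply: exp_pos.
rewrite -exp_plus.
have -> : d / 2 + (ln (1 + exp r) - d) = - (d / 2) + ln (1 + exp r) by lra.
rewrite !exp_plus exp_ln; last lra.
have := exp_increasing (- (d / 2)) 0 ltac:(lra); rewrite exp_0.
have := exp_pos (- (d / 2)); nra.
Qed.

Lemma eventually_upper_rate u r :
  (forall d, 0 < d -> exists N, forall n, (N <= n)%N -> INR (u n) <= exp (r + d) ^ n) ->
  upper_rate u r.
Proof.
move=> hu d d0; have [N hN] := hu d d0; have p := exp_pos (r + d).
have : exists2 K, 0 < K & forall n, (n < N)%N -> INR (u n) <= K * exp (r + d) ^ n.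
  elim: N {hN} => [|N [K K0 hK]]; first by exists 1; first lra.
  have X0 := pow_lt _ N p; have u0 := pos_INR (u N).
  have D0 : 0 <= INR (u N) / exp (r + d) ^ N by apply: Rmult_le_pos => //; apply/Rlt_le/Rinv_0_lt_compat.
  exists (K + INR (u N) / exp (r + d) ^ N); first lra.
  move=> n; rewrite ltnS leq_eqVlt => /orP [/eqP ->|/hK h].
    have -> : (K + INR (u N) / exp (r + d) ^ N) * exp (r + d) ^ N =
      K * exp (r + d) ^ N + INR (u N) by field; lra.
    nra.
  have := pow_lt _ n p; nra.
move=> [K K0 hK]; exists (K + 1); first lra.
move=> n; have Xn := pow_lt _ n p; case: (ltnP n N) => h.
  by have := hK n h; nra.
by have := hN n h; nra.
Qed.

Lemma eventually_lower_rate u r : (forall n, (0 < u n)%N) ->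
  (forall d, 0 < d -> exists N, forall n, (N <= n)%N -> exp (r - d) ^ n <= INR (u n)) ->
  lower_rate u r.
Proof.
move=> u0 hu d d0; have [N hN] := hu d d0; have p := exp_pos (r - d).
have : exists2 K, 0 < K <= 1 & forall n, (n < N)%N -> K * exp (r - d) ^ n <= INR (u n).
  elim: N {hN} => [|N [K K0 hK]]; first by exists 1; first lra.
  have X0 := pow_lt _ N p; have uN : 1 <= INR (u N) by apply: (@INR_leq 1); exact: u0.
  pose k := Rmin K (/ exp (r - d) ^ N).
  have k0 : 0 < k by apply: Rmin_glb_lt; [lra|apply: Rinv_0_lt_compat].
  have k1 := Rmin_l K (/ exp (r - d) ^ N); have k2 := Rmin_r K (/ exp (r - d) ^ N).
  rewrite -/k in k1 k2; exists k; first lra.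
  move=> n; rewrite ltnS leq_eqVlt => /orP [/eqP ->|/hK h].
    apply: Rle_trans uN; have -> : 1 = / exp (r - d) ^ N * exp (r - d) ^ N by field; lra.
    by apply: Rmult_le_compat_r; lra.
  have := pow_lt _ n p; nra.
move=> [K K0 hK]; exists K; first lra.
move=> n; have Xn := pow_lt _ n p; case: (ltnP n N) => h; first exact: hK.
by have := hN n h; nra.
Qed.

End Growth.

(** * Fekete's lemma for subadditive sequences *)

Section Fekete.
Local Open Scope R_scope.
Variable k : nat -> nat.
Hypothesis k_sub : forall a b, (k (a + b) <= k a + k b)%N.

Lemma subadd_muln q n r : (k (q * n + r) <= q * k n + k r)%N.
Proof.
elim: q => [|q IH]; first by rewrite !mul0n.
by have := k_sub n (q * n + r); rewrite !mulSn -!addnA; lia.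
Qed.

(** The limit is the infimum of the ratios: dividing [n] by some [n0] with nearly minimal ratio
    leaves an error bounded independently of [n]. *)
Lemma subadd_cv : exists2 beta,
  Un_cv (fun n => INR (k n) / INR n) beta &
  forall n, (0 < n)%N -> beta <= INR (k n) / INR n.
Proof.
(* The ratios are negated because completeness provides suprema. *)
pose E x := exists2 n, (0 < n)%N & x = - (INR (k n) / INR n).
have q0 n : 0 <= INR (k n) / INR n.
  case: n => [|n]; first by rewrite /= /Rdiv Rinv_0 Rmult_0_r; lra.
  by apply: Rmult_le_pos; [apply: pos_INR|apply/Rlt_le/Rinv_0_lt_compat/lt_0_INR; lia].
have bE : bound E by exists 0 => x [n _ ->]; have := q0 n; lra.
have [|B [hB1 hB2]] := completeness E bE; first by exists (- (INR (k 1) / INR 1)), 1%N.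
have lo n : (0 < n)%N -> - B <= INR (k n) / INR n.
  by move=> n0; have := hB1 (- (INR (k n) / INR n)) ltac:(by exists n); lra.
exists (- B) => // e e0.
have [n0 n0p hn0] : exists2 n0, (0 < n0)%N & INR (k n0) / INR n0 < - B + e / 2.
  case: (excluded_middle_informative (exists2 n0, (0 < n0)%N & INR (k n0) / INR n0 < - B + e / 2)) => // h.
  have : B <= B - e / 2; last lra.
  apply: hB2 => x [n np ->].
  have [//|h2] := Rle_lt_dec (- (INR (k n) / INR n)) (B - e / 2).
  by case: h; exists n => //; lra.
(* [M] bounds [k] at all remainders modulo [n0]; subadditivity does not force [k 0] to vanish. *)
pose M := (n0 * k 1 + k 0)%N.
have [N hN] := INR_unbounded (INR M * 2 / e); exists N.+1 => n nN.
have np : 0 < INR n by apply: lt_0_INR; lia.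
have n0P : 0 < INR n0 by apply: lt_0_INR; lia.
have h1 : (n0 * k n <= n * k n0 + n0 * M)%N.
  have h2 := subadd_muln (n %/ n0) n0 (n %% n0); rewrite -divn_eq in h2.
  have h3 := subadd_muln (n %% n0) 1 0; rewrite muln1 addn0 in h3.
  have h4 : (n %% n0 * k 1 <= n0 * k 1)%N by rewrite leq_mul2r ltnW ?ltn_mod ?orbT.
  have h5 : (k n <= n %/ n0 * k n0 + M)%N by rewrite /M; lia.
  apply: leq_trans (leq_mul (leqnn n0) h5) _; rewrite mulnDr leq_add2r mulnA.
  by rewrite leq_mul2r mulnC leq_divM orbT.
have := INR_leq h1; rewrite plus_INR !mult_INR => h2.
have h3 : INR (k n) / INR n <= INR (k n0) / INR n0 + INR M / INR n.
  apply: (Rmult_le_reg_l (INR n0 * INR n)); first exact: Rmult_lt_0_compat.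
  have -> : INR n0 * INR n * (INR (k n) / INR n) = INR n0 * INR (k n) by field; lra.
  have -> // : INR n0 * INR n * (INR (k n0) / INR n0 + INR M / INR n) =
    INR n * INR (k n0) + INR n0 * INR M by field; lra.
have h4 : INR M / INR n < e / 2.
  apply: (Rmult_lt_reg_r (INR n * 2 / e)).
    by apply: Rdiv_lt_0_compat; lra.
  have -> : INR M / INR n * (INR n * 2 / e) = INR M * 2 / e by field; lra.
  have -> : e / 2 * (INR n * 2 / e) = INR n by field; lra.
  by apply: Rlt_le_trans hN _; apply: INR_leq; lia.
have := lo n ltac:(lia).
by rewrite /Rdist; move=> h5; apply: Rabs_def1; lra.
Qed.

End Fekete.

(** * Limits of the ratios [k n / n] *)

Section RatioLimits.
Local Open Scope R_scope.
Variables (k l : nat -> nat) (beta : R).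
Hypothesis k_cv : Un_cv (fun n => INR (k n) / INR n) beta.

Lemma cv_ratio_gt0 c : (forall n, n <= c.+1 * k n)%N -> 0 < beta.
Proof.
move=> hk; have m0 : 0 < INR c.+1 by apply: lt_0_INR; lia.
have mp := Rinv_0_lt_compat _ m0.
have [//|b0] := Rlt_le_dec 0 beta.
have [N hN] := k_cv mp.
have := hN N.+1 ltac:(lia); rewrite /Rdist => /Rabs_def2 [a _].
have n0 : 0 < INR N.+1 by apply: lt_0_INR; lia.
have h := INR_leq (hk N.+1); rewrite mult_INR in h.
have : / INR c.+1 <= INR (k N.+1) / INR N.+1.
  apply: (Rmult_le_reg_l (INR c.+1 * INR N.+1)); first exact: Rmult_lt_0_compat.
  have -> : INR c.+1 * INR N.+1 * / INR c.+1 = INR N.+1 by field; lra.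
  by have -> : INR c.+1 * INR N.+1 * (INR (k N.+1) / INR N.+1) = INR c.+1 * INR (k N.+1) by field; lra.
lra.
Qed.

(** The ratios differ by at most [1 / n]. This passes the limit from the maximal number of b's to
    the number of odd variables in a witness. *)
Lemma cv_ratio_close : (forall n, k n <= (l n).+1)%N -> (forall n, l n <= (k n).+1)%N ->
  Un_cv (fun n => INR (l n) / INR n) beta.
Proof.
move=> kl lk e e0; have e2 : 0 < e / 2 by lra.
have [N1 h1] := k_cv e2.
have [N2 h2] := INR_unbounded (2 / e); exists (N1 + N2).+1 => n hn.
have := h1 n ltac:(lia); rewrite /Rdist => /Rabs_def2 [a b].
have c1 := INR_leq (kl n); have c2 := INR_leq (lk n); rewrite !S_INR in c1 c2.
have hN2 : 2 / e < INR n by apply: Rlt_le_trans h2 _; apply: INR_leq; lia.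
have n0 : 0 < INR n by apply: lt_0_INR; lia.
have d : / INR n < e / 2.
  have -> : e / 2 = / (2 / e) by field; lra.
  apply: Rinv_lt_contravar => //; apply: Rmult_lt_0_compat => //.
  by apply: Rdiv_lt_0_compat; lra.
have i0 := Rinv_0_lt_compat _ n0.
by apply: Rabs_def1; move: a b; rewrite /Rdiv; nra.
Qed.

End RatioLimits.

(** * Binomial coefficients and binary entropy *)

Section BinomialEntropy.

(** A single term of the binomial expansion of [((n - k) + k) ^ n] cannot exceed the sum. *)
Lemma bin_entropy_le n k : k <= n -> 'C(n, k) * (k ^ k * (n - k) ^ (n - k)) <= n ^ n.
Proof.
move=> kn; rewrite -{4}(subnK kn) expnDn.
have kl : k < n.+1 by [].
by rewrite (bigD1 (Ordinal kl)) //= [(n - k) ^ _ * _]mulnC; apply: leq_addr.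
Qed.

(* The k-th term of the binomial expansion of ((n - k) + k) ^ n is its largest one. *)
Lemma bin_entropy_ge n k : k <= n -> n ^ n <= n.+1 * ('C(n, k) * (k ^ k * (n - k) ^ (n - k))).
Proof.
move=> kn; rewrite -{1}(subnK kn) expnDn.
pose T j := 'C(n, j) * ((n - k) ^ (n - j) * k ^ j).
(* Cross-multiplied ratio of consecutive terms, [k (n - j) / ((j + 1) (n - k))]: at least 1 for
   [j < k], at most 1 for [k <= j]. *)
have step j : j < n -> T j.+1 * (j.+1 * (n - k)) = T j * (k * (n - j)).
  move=> jn; rewrite /T -(subnSK jn) !expnS.
  have := mul_bin_left n j; rewrite -(subnSK jn); set c := 'C(n, j.+1); set c' := 'C(n, j).
  set s := (n - j.+1).+1; set a := (n - k) ^ _; set b := k ^ _ => e.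
  transitivity ((j.+1 * c) * (a * b * k * (n - k))); first by lia.
  by rewrite e; lia.
have up j : j < k -> T j <= T j.+1.
  move=> jk; have [nk|nk] := posnP (n - k).
    have -> : T j = 0; last by [].
    have e : n - j = (n - j.+1).+1 by lia.
    by rewrite /T nk e expnS mul0n mul0n muln0.
  have p : 0 < j.+1 * (n - k) by rewrite muln_gt0.
  rewrite -(leq_pmul2r p) step; last by lia.
  by rewrite leq_mul2l; apply/orP; right; nia.
have down j : k <= j -> j < n -> T j.+1 <= T j.
  move=> kj jn; have [k0|k0] := posnP k; first by rewrite /T k0 expnS mul0n muln0 muln0.
  have p : 0 < j.+1 * (n - k) by rewrite muln_gt0; lia.
  rewrite -(leq_pmul2r p) step //.
  by rewrite leq_mul2l; apply/orP; right; nia.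
have upk d : d <= k -> T (k - d) <= T k.
  elim: d => [|d IH] dk; first by rewrite subn0.
  apply: leq_trans (IH (ltnW dk)).
  by rewrite -[k - d](subnSK dk); apply: up; lia.
have downk d : k + d <= n -> T (k + d) <= T k.
  elim: d => [|d IH] dk; first by rewrite addn0.
  apply: leq_trans (IH _); last by lia.
  by rewrite addnS; apply: down; lia.
have all j : j <= n -> T j <= T k.
  move=> jn; case: (leqP j k) => h.
    by rewrite -(subKn h); apply: upk; lia.
  by rewrite -(subnKC (ltnW h)); apply: downk; lia.
apply: leq_trans (_ : \sum_(i < n.+1) T k <= _).
  by apply: leq_sum => i _; apply: all; rewrite -ltnS.
by rewrite sum_nat_const card_ord leq_mul2l /T [_ * k ^ k]mulnC leqnn orbT.
Qed.

Local Open Scope R_scope.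

Lemma ln_INR_expn a b : (0 < a)%N -> ln (INR (a ^ b)%N) = INR b * ln (INR a).
Proof.
move=> a0; have a0' : 0 < INR a by apply: lt_0_INR; lia.
have h c : 0 < INR (a ^ c)%N by apply: lt_0_INR; apply/ltP; rewrite expn_gt0 a0.
elim: b => [|b IH]; first by rewrite expn0 /= ln_1; lra.
by rewrite expnS mult_INR ln_mult // IH S_INR; ring.
Qed.

Definition entropy (t : R) := - (t * ln t) - (1 - t) * ln (1 - t).

Lemma continuity_pt_ln x : 0 < x -> continuity_pt ln x.
Proof.
move=> x0; apply: derivable_continuous_pt.
by exists (/ x); apply: derivable_pt_lim_ln.
Qed.

Lemma continuity_pt_entropy t : 0 < t < 1 -> continuity_pt entropy t.
Proof.
move=> [t0 t1].
have hid x : continuity_pt id x by apply: derivable_continuous_pt; apply: derivable_pt_id.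
have hm x : continuity_pt (fun u => 1 - u) x.
  by apply: (continuity_pt_minus (fct_cte 1) id) => //; apply: continuity_pt_const.
apply: (continuity_pt_minus (fun t => - (t * ln t)) (fun t => (1 - t) * ln (1 - t))).
  apply: (continuity_pt_opp (fun t => t * ln t)); apply: (continuity_pt_mult id ln) => //.
  exact: continuity_pt_ln.
apply: (continuity_pt_mult (fun u => 1 - u) (fun t => ln (1 - t))) => //.
by apply: (continuity_pt_comp (fun u => 1 - u) ln) => //; apply: continuity_pt_ln; lra.
Qed.

(** Logarithms of the two integer estimates above; strictness of [0 < k < n] keeps all their
    arguments positive. *)
Lemma ln_bin_bounds n k : (0 < k < n)%N ->
  INR n * entropy (INR k / INR n) - ln (INR n.+1) <= ln (INR 'C(n, k)) <=
  INR n * entropy (INR k / INR n).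
Proof.
move=> /andP[k0 kn].
have P a : (0 < a)%N -> 0 < INR a by move=> h; apply: lt_0_INR; lia.
have Pe a b : (0 < a)%N -> 0 < INR (a ^ b)%N by move=> h; apply: P; rewrite expn_gt0 h.
have n0 : (0 < n)%N by lia.
have nk0 : (0 < n - k)%N by lia.
have C0 : (0 < 'C(n, k))%N by rewrite bin_gt0 ltnW.
have e1 : INR (n - k)%N = INR n - INR k by apply: minus_INR; lia.
have -> : INR n * entropy (INR k / INR n) =
  INR n * ln (INR n) - INR k * ln (INR k) - INR (n - k)%N * ln (INR (n - k)%N).
  have -> : entropy (INR k / INR n) =
      - (INR k / INR n * ln (INR k / INR n)) - INR (n - k)%N / INR n * ln (INR (n - k)%N / INR n).
    rewrite /entropy; have -> // : 1 - INR k / INR n = INR (n - k)%N / INR n.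
    by rewrite e1; field; have := P _ n0; lra.
  rewrite /Rdiv !ln_mult ?ln_Rinv; try (by apply: P) ; try (by apply/Rinv_0_lt_compat/P).
  by rewrite e1; field; have := P _ n0; lra.
have l1 := INR_leq (bin_entropy_le (ltnW kn)); have l2 := INR_leq (bin_entropy_ge (ltnW kn)).
rewrite !mult_INR in l1 l2.
have Q : 0 < INR 'C(n, k) * (INR (k ^ k)%N * INR ((n - k) ^ (n - k))%N).
  by repeat (apply: Rmult_lt_0_compat; try (by apply: P); try (by apply: Pe)).
move: (ln_le Q l1) (ln_le (Pe n n n0) l2).
by rewrite !ln_mult ?ln_INR_expn //; try (by apply: Pe); try (by apply: P);
  repeat (apply: Rmult_lt_0_compat; try (by apply: P); try (by apply: Pe)); lra.
Qed.

Variables (l : nat -> nat) (beta : R).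
Hypothesis l_le : forall n, (l n <= n)%N.
Hypothesis beta01 : 0 < beta < 1.
Hypothesis l_cv : Un_cv (fun n => INR (l n) / INR n) beta.

(** As [beta] lies strictly between 0 and 1, so does the ratio eventually, and the entropy is
    continuous at [beta]. *)
Lemma cv_frac_eventually d : 0 < d -> exists N, forall n, (N <= n)%N ->
  (0 < l n < n)%N /\ Rabs (entropy (INR (l n) / INR n) - entropy beta) < d.
Proof.
move=> d0.
have [N1 h1] := continuity_seq _ _ _ (continuity_pt_entropy beta01) l_cv d d0.
have m0 : 0 < Rmin beta (1 - beta) by apply: Rmin_glb_lt; lra.
have [N2 h2] := l_cv m0.
exists (N1 + N2).+1 => n hn; split; last by apply: h1; lia.
have := h2 n ltac:(lia); rewrite /Rdist => /Rabs_def2 [a b].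
have := Rmin_l beta (1 - beta); have := Rmin_r beta (1 - beta) => c1 c2.
have n0 : 0 < INR n by apply: lt_0_INR; lia.
apply/andP; split; rewrite ltnNge; apply/negP => h.
  by move: a b; have -> : l n = 0%N; [lia|rewrite /Rdiv Rmult_0_l; lra].
have e : l n = n by apply/eqP; rewrite eqn_leq l_le.
by move: a b; rewrite e /Rdiv Rinv_r; lra.
Qed.

Lemma upper_rate_binomial : upper_rate (fun n => 'C(n, l n)) (entropy beta).
Proof.
apply: eventually_upper_rate => d d0; have [N hN] := cv_frac_eventually d0.
exists N => n /hN [ln0 /Rabs_def2 [a b]]; have [_ h] := ln_bin_bounds ln0.
have C0 : 0 < INR 'C(n, l n) by apply: lt_0_INR; apply/ltP; rewrite bin_gt0.
rewrite exp_pow -(exp_ln _ C0); have := pos_INR n => n0.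
have [lt|->] : ln (INR 'C(n, l n)) <= INR n * (entropy beta + d); last exact: Rle_refl.
  by apply: Rle_trans h _; apply: Rmult_le_compat_l; lra.
by left; apply: exp_increasing.
Qed.

Lemma lower_rate_binomial : lower_rate (fun n => 'C(n, l n)) (entropy beta).
Proof.
apply: eventually_lower_rate => [n|d d0]; first by rewrite bin_gt0.
have d2 : 0 < d / 2 by lra.
have [N hN] := cv_frac_eventually d2.
(* Once [16 <= n * d ^ 2], one has [n + 1 <= (1 + n * d / 4) ^ 2 <= exp (n * d / 2)], so the loss
   [ln (n + 1)] costs half of the slack. *)
have [N' hN'] := INR_unbounded (16 / (d * d)).
exists (N + N')%N => n hn; have [ln0 /Rabs_def2 [a b]] := hN n ltac:(lia).
have [h _] := ln_bin_bounds ln0.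
have C0 : 0 < INR 'C(n, l n) by apply: lt_0_INR; apply/ltP; rewrite bin_gt0.
rewrite exp_pow -(exp_ln _ C0); have n0 := pos_INR n.
have key : ln (INR n.+1) <= INR n * (d / 2).
  rewrite -[X in _ <= X]ln_exp; apply: ln_le; first by apply: lt_0_INR; lia.
  have -> : INR n * (d / 2) = INR n * d / 4 + INR n * d / 4 by lra.
  rewrite exp_plus S_INR; have := exp_ineq1_le (INR n * d / 4) => e1.
  have nd : 0 <= INR n * d / 4 by nra.
  have n16 : 16 <= INR n * (d * d).
    have : 16 / (d * d) <= INR n by apply: Rle_trans (Rlt_le _ _ hN') _; apply: INR_leq; lia.
    have dd : 0 < d * d by nra.
    by move=> /(Rmult_le_compat_r _ _ _ (Rlt_le _ _ dd)); have -> : 16 / (d * d) * (d * d) = 16 by field; lra.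
  have : (1 + INR n * d / 4) * (1 + INR n * d / 4) <= exp (INR n * d / 4) * exp (INR n * d / 4).
    by apply: Rmult_le_compat; lra.
  nra.
have [lt|->] : INR n * (entropy beta - d) <= ln (INR 'C(n, l n)); last exact: Rle_refl.
  apply: Rle_trans h.
  have : INR n * (entropy beta - d / 2) <= INR n * entropy (INR (l n) / INR n).
    by apply: Rmult_le_compat_l; lra.
  lra.
by left; apply: exp_increasing.
Qed.

End BinomialEntropy.

(** * The path word of A(m, w) *)

Section Path.
Variables (m : nat) (w : nat -> bool).

(* Right multiplication by a or b moves z_j^{(i)} along the single infinite path
   z_1^{(1)}, z_2^{(1)}, ..., z_1^{(2)}, ...; [path_pos t] is the pair (i, j) of its t-th
   vertex and [path_letter t] tells whether the edge leaving it is b. *)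
Definition next_pos (l : nat -> nat) (P : nat * nat) :=
  if P.2 < l P.1 then (P.1, P.2.+1) else (P.1.+1, 1).

Definition path_pos t := iter t (next_pos (len m w)) (1, 1).

Definition path_letter t := ~~ ((path_pos t).2 < len m w (path_pos t).1).

Definition factor t n := map path_letter (iota t n).

Lemma size_factor t n : size (factor t n) = n.
Proof. by rewrite size_map size_iota. Qed.

Lemma factor_rcons t n : factor t n.+1 = rcons (factor t n) (path_letter (t + n)).
Proof. by rewrite /factor -addn1 iotaD map_cat cats1. Qed.

Lemma factor_cat t a b : factor t (a + b) = factor t a ++ factor (t + a) b.
Proof. by rewrite /factor iotaD map_cat. Qed.

(** Row lengths and starting position are parameters, so that the path word can be read from a
    translated finite stretch of [w]. *)
Fixpoint read_word (l : nat -> nat) (P : nat * nat) (n : nat) : seq bool :=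
  if n is n'.+1 then ~~ (P.2 < l P.1) :: read_word l (next_pos l P) n' else [::].

Lemma factor_read t n : factor t n = read_word (len m w) (path_pos t) n.
Proof. by elim: n t => //= n IH t; congr cons; apply: (IH t.+1). Qed.

(** Reading [n] letters consults at most [n] consecutive rows, so only their lengths have to
    agree. *)
Lemma read_word_shift l l' i r j n :
  (forall u, r <= u < r + n -> l' u = l (i + u)) ->
  read_word l' (r, j) n = read_word l (i + r, j) n.
Proof.
elim: n r j => //= n IH r j e; rewrite e; last by lia.
congr cons; rewrite /next_pos /= e; last by lia.
case: ifP => _; first by apply: IH => u hu; apply: e; lia.
by rewrite -addnS; apply: IH => u hu; apply: e; lia.
Qed.

Lemma max_count_exists q :
  exists k, (exists t, count id (factor t q) = k) /\ forall t, count id (factor t q) <= k.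
Proof.
have [//|h] := excluded_middle_informative
  (exists k, (exists t, count id (factor t q) = k) /\ forall t, count id (factor t q) <= k).
suff H k : exists t, k <= count id (factor t q).
  by have [t ht] := H q.+1; have := count_size id (factor t q); rewrite size_factor; lia.
elim: k => [|k [t ht]]; first by exists 0.
have [[t' e]//|h'] := excluded_middle_informative (exists t, k < count id (factor t q)); first by exists t'.
case: h; exists k; split; last first.
  by move=> t'; rewrite leqNgt; apply/negP => h; apply: h'; exists t'.
exists t; apply/eqP; rewrite eqn_leq ht andbT leqNgt.
by apply/negP => h; apply: h'; exists t.
Qed.

Definition max_count q := proj1_sig (constructive_indefinite_description _ (max_count_exists q)).

Lemma max_count_attained q : exists t, count id (factor t q) = max_count q.
Proof. by rewrite /max_count; case: constructive_indefinite_description => k []. Qed.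

Lemma count_le_max t q : count id (factor t q) <= max_count q.
Proof. by rewrite /max_count; case: constructive_indefinite_description => k []. Qed.

Lemma max_count_sub a b : max_count (a + b) <= max_count a + max_count b.
Proof.
have [t <-] := max_count_attained (a + b).
by rewrite factor_cat count_cat leq_add ?count_le_max.
Qed.

Hypothesis m2 : 2 <= m.

Lemma len_ge2 i : 2 <= len m w i. Proof. by rewrite /len; lia. Qed.

Lemma len_le i : len m w i <= m.+1. Proof. by rewrite /len; case: (w i); lia. Qed.

Lemma path_pos_valid t :
  [&& 1 <= (path_pos t).1, 1 <= (path_pos t).2 & (path_pos t).2 <= len m w (path_pos t).1].
Proof.
elim: t => [|t]; first by have := len_ge2 1; rewrite /=; lia.
rewrite /path_pos iterS -/(path_pos t); case: (path_pos t) => i j /= /and3P [h1 h2 h3].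
rewrite /next_pos /=; have := len_ge2 i.+1; case: ifP => /=; lia.
Qed.

Lemma path_pos_run t d : (path_pos t).2 + d <= len m w (path_pos t).1 ->
  path_pos (t + d) = ((path_pos t).1, (path_pos t).2 + d).
Proof.
elim: d => [|d IH] h; first by rewrite !addn0; case: (path_pos t).
rewrite addnS /path_pos iterS -/(path_pos _) IH; last by lia.
by rewrite /next_pos /= addnS; case: ifP => //; lia.
Qed.

Lemma path_pos_surj i j : 1 <= i -> 1 <= j <= len m w i -> exists t, path_pos t = (i, j).
Proof.
move=> i1; suff [t et] : exists t, path_pos t = (i, 1).
  move=> hj; exists (t + (j - 1)); rewrite path_pos_run et /=; last by lia.
  by congr pair; lia.
case: i i1 => // i _; elim: i => [|i [t et]]; first by exists 0.
exists (t + (len m w i.+1 - 1)).+1; have h := len_ge2 i.+1.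
rewrite /path_pos iterS -/(path_pos _) path_pos_run et /=; last by lia.
by rewrite /next_pos /=; case: ifP => //; lia.
Qed.

(** An edge b leads to the first vertex of a row of length at least two, and the edge leaving that
    vertex is a. *)
Lemma path_letter_gap t : path_letter t -> ~~ path_letter t.+1.
Proof.
rewrite /path_letter /path_pos iterS -/(path_pos t) /next_pos => /negbTE -> /=.
by rewrite negbK; apply: len_ge2.
Qed.

Lemma count_factor_gap t n : 2 * count id (factor t n) <= n.+1.
Proof.
elim/ltn_ind: n t => -[|[|n]] IH t //=; first by case: (path_letter t).
have := IH n.+1 (leqnn _) t.+1; have := IH n (ltnW (leqnn _)) t.+2.
rewrite /factor /=; have := @path_letter_gap t.
by case: (path_letter t) => /=; [move=> /(_ isT) /negbTE ->; lia|lia].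
Qed.

(** A row has at most [m + 1] vertices, so the path leaves its current row within [m + 1] edges. *)
Lemma count_factor_run t : 1 <= count id (factor t m.+1).
Proof.
have /and3P [h1 h2 h3] := path_pos_valid t; have h4 := len_le (path_pos t).1.
rewrite -has_count; apply/hasP; exists (path_letter (t + (len m w (path_pos t).1 - (path_pos t).2))).
  by apply: map_f; rewrite mem_iota; lia.
rewrite /path_letter path_pos_run /=; last by lia.
by rewrite -leqNgt; lia.
Qed.

Lemma max_count_half q : 2 * max_count q <= q.+1.
Proof. by have [t <-] := max_count_attained q; apply: count_factor_gap. Qed.

Lemma max_countS q : max_count q <= max_count q.+1 <= (max_count q).+1.
Proof.
apply/andP; split.
  have [t <-] := max_count_attained q; apply: leq_trans (count_le_max t q.+1).
  by rewrite factor_rcons -cats1 count_cat leq_addr.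
have := max_count_sub q 1; have := max_count_half 1; rewrite addn1; lia.
Qed.

(** A window of length [q * m.+1] contains at least [q] letters b, and by subadditivity at most
    [m.+1 * max_count q]. This makes the limiting frequency positive. *)
Lemma max_count_run q : q <= m.+1 * max_count q.
Proof.
apply: (@leq_trans (max_count (q * m.+1))).
  apply: leq_trans (count_le_max 0 _); elim: q 0 => [|q IH] t //.
  by rewrite mulSn factor_cat count_cat; have := IH (t + m.+1); have := count_factor_run t; lia.
rewrite mulnC; elim: (m.+1) => [|n IH].
  by have := max_count_half 0; rewrite !mul0n; lia.
by rewrite !mulSn; apply: leq_trans (max_count_sub _ _) _; lia.
Qed.

(** A factor is determined by the place [j] in its starting row, at most [m + 1] choices, and by the
    [n] letters of [w] from that row on. *)
Lemma factors_linear (C : nat) :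
  (forall n, exists2 s : seq (seq bool), size s <= C * n.+1 &
     forall i, 1 <= i -> subword w i n \in s) ->
  forall n, exists2 s : seq (seq bool), size s <= m.+1 * C * n.+1 &
    forall t, factor t n \in s.
Proof.
move=> hw n; have [s ss hs] := hw n.
exists [seq read_word (fun r => m + nth false u r) (0, j) n | j <- iota 1 m.+1, u <- s].
  by rewrite size_allpairs size_iota -mulnA leq_mul2l ss orbT.
move=> t; rewrite factor_read; have /and3P [h1 h2 h3] := path_pos_valid t.
have h4 := len_le (path_pos t).1.
case: (path_pos t) h1 h2 h3 h4 => i j h1 h2 h3 h4; rewrite [_.1]/= [_.2]/= in h1 h2 h3 h4.
apply/allpairsPdep; exists j, (subword w i n); split; [by rewrite mem_iota; lia|exact: hs|].
rewrite -{1}[i]addn0; symmetry; apply: read_word_shift => u; rewrite add0n => /andP [_ un].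
by rewrite /len (nth_map 0) ?size_iota // nth_iota.
Qed.

End Path.

Lemma sturmian_or_periodic_linear w : sturmian w \/ periodic_word w ->
  exists C, forall n, exists2 s : seq (seq bool), size s <= C * n.+1 &
     forall i, 1 <= i -> subword w i n \in s.
Proof.
case=> [st|[p p0 hp]].
  (* The Sturmian condition concerns positive lengths only; length 0 has just the empty word. *)
  exists 1 => -[|n]; first by exists [:: [::]].
  have [s [_ ss hs]] := st n.+1 isT; exists s; first by rewrite ss mul1n.
  by move=> i i1; apply/hs; exists i.
exists p => n; exists [seq subword w i n | i <- iota 1 p].
  by rewrite size_map size_iota leq_pmulr.
have shift i c : 1 <= i -> w (i + c * p) = w i.
  by move=> i1; elim: c => [|c IH]; rewrite ?addn0 // mulSn addnCA addnC hp //; lia.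
move=> i i1; apply/mapP; exists ((i - 1) %% p).+1.
  by rewrite mem_iota; have := ltn_pmod (i - 1) p0; lia.
apply: eq_map => t; rewrite -[RHS](shift _ ((i - 1) %/ p)); last by lia.
by congr w; have := divn_eq (i - 1) p; lia.
Qed.

(** * Codimensions and linear functionals *)

From mathcomp Require Import ring.

Section Codimension.
Variable F : fieldType.
Local Open Scope ring_scope.

Definition lin (psi : nmon -> F) (f : npoly F) : F := \sum_(p <- f) p.1 * psi p.2.

Lemma eq_lin psi psi' f : (forall p, List.In p f -> psi p.2 = psi' p.2) ->
  lin psi f = lin psi' f.
Proof.
rewrite /lin; elim: f => [|p f IH] h; first by rewrite !big_nil.
by rewrite !big_cons h ?IH //=; [move=> q hq; apply: h; right|left].
Qed.

Lemma lin_lincomb psi cs fs :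
  lin psi (lincomb cs fs) = \sum_(cf <- zip cs fs) cf.1 * lin psi cf.2.
Proof.
rewrite /lin /lincomb big_flatten big_map; apply: eq_bigr => cf _.
by rewrite big_map mulr_sumr; apply: eq_bigr => p _; rewrite mulrA.
Qed.

Lemma sum_zip n (cs : seq F) (fs : seq (npoly F)) (g : npoly F -> F) :
  size cs = n -> size fs = n ->
  \sum_(cf <- zip cs fs) cf.1 * g cf.2 = \sum_(i < n) cs`_i * g (nth [::] fs i).
Proof.
move=> hc hf; rewrite (big_nth (0, [::])) size_zip hc hf minnn big_mkord.
by apply: eq_bigr => i _; rewrite nth_zip ?hc ?hf.
Qed.

Lemma in_P_lincomb k l (cs : seq F) fs :
  (forall f, List.In f fs -> in_P k l f) -> in_P k l (lincomb cs fs).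
Proof.
rewrite /lincomb; elim: fs cs => [|f fs IH] [|c cs] h //=.
move=> p /(@List.in_app_or _ _ _ p) [|]; last by apply: IH => // g hg; apply: h; right.
move=> hp; have {h} : in_P k l f by apply: h; left.
elim: f hp => [|q f IHf] //= [<- h|hp h]; first by apply: (h q); left.
by apply: IHf => // r hr; apply: h; right.
Qed.

Variable B : galg F.

(** [codim] is chosen by [epsilon], so its specification is available only once a largest
    independent family exists; any bound [D] on the sizes provides one. *)
Lemma is_codim_codim k l D :
  (forall fs, indep_mod_Id B k l fs -> (size fs <= D)%N) ->
  is_codim B k l (codim B k l).
Proof.
move=> hD; rewrite /codim.
pose P d := exists fs, size fs = d /\ indep_mod_Id B k l fs.
suff [d hd] : exists d, is_codim B k l d by apply: epsilon_spec; exists d.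
suff H n : (exists d, is_codim B k l d) \/ exists2 d, (n <= d)%N & P d.
  by have [//|[d dD [fs [e /hD]]]] := H D.+1; rewrite e leqNgt dD.
elim: n => [|n [|[d nd Pd]]]; [right|by left|].
  by exists 0%N => //; exists [::]; split => //; split => // -[].
have [[d' dd' Pd']|h] := excluded_middle_informative (exists2 d', (d < d')%N & P d').
  by right; exists d' => //; apply: leq_ltn_trans dd'.
left; exists d; split => // fs hfs; rewrite leqNgt; apply/negP => hs.
by apply: h; exists (size fs) => //; exists fs.
Qed.

(** With more polynomials than functionals, the matrix of values has a nonzero left kernel vector;
    the combination with these coefficients is killed by all functionals, hence is an identity. *)
Lemma indep_size_le k l (psis : seq (nmon -> F)) :
  (forall f, in_P k l f -> (forall psi, List.In psi psis -> lin psi f = 0) ->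
     is_gr_identity B f) ->
  forall fs, indep_mod_Id B k l fs -> (size fs <= size psis)%N.
Proof.
move=> hpsi fs [hP hfs]; rewrite leqNgt; apply/negP => lt.
pose M := \matrix_(i < size fs, j < size psis) lin (nth (fun=> 0) psis j) (nth [::] fs i).
have : kermx M != 0.
  rewrite -mxrank_eq0 mxrank_ker subn_eq0 -ltnNge.
  exact: leq_ltn_trans (rank_leq_col M) lt.
case/rowV0Pn => v /sub_kermxP vM v0.
pose cs := [seq v 0 i | i <- enum 'I_(size fs)].
have scs : size cs = size fs by rewrite size_map size_enum_ord.
have csE (i : 'I_(size fs)) : cs`_i = v 0 i.
  by rewrite (nth_map i) ?size_enum_ord // nth_ord_enum.
apply: (hfs cs) => //.
  have [i vi] : exists i, v 0 i != 0.
    apply/existsP; apply: contraNT v0; rewrite negb_exists => /forallP h.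
    by apply/eqP/rowP => i; rewrite mxE; apply/eqP; have := h i; rewrite negbK.
  by apply/hasP; exists (v 0 i) => //; apply: map_f; rewrite mem_enum.
apply: hpsi; first exact: in_P_lincomb.
move=> psi /(List.In_nth _ _ (fun=> 0)) [j []].
have sl T (s : seq T) : length s = size s by elim: s => //= x s ->.
rewrite sl => /ltP jl hj.
have hj' : nth (fun=> 0) psis j = psi.
  by rewrite -hj; elim: psis j {hj M vM lt jl} => [|x s IH] [|j] //=.
rewrite lin_lincomb (sum_zip _ scs) //.
have := congr1 (fun N : 'rV_(size psis) => N 0 (Ordinal jl)) vM; rewrite !mxE => e; rewrite -[RHS]e.
by apply: eq_bigr => i _; rewrite csE mxE hj'.
Qed.

Lemma codim_le k l (psis : seq (nmon -> F)) :
  (forall f, in_P k l f -> (forall psi, List.In psi psis -> lin psi f = 0) ->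
     is_gr_identity B f) ->
  (codim B k l <= size psis)%N.
Proof.
move=> h; have [[fs [<- hfs]] _] := is_codim_codim (indep_size_le h).
exact: indep_size_le hfs.
Qed.

Lemma codim_ge k l D fs :
  (forall fs, indep_mod_Id B k l fs -> (size fs <= D)%N) ->
  indep_mod_Id B k l fs -> (size fs <= codim B k l)%N.
Proof. by move=> h; apply: (is_codim_codim h).2. Qed.

(** A functional that sees the monomials of [f] only through [key] is a combination of indicators of
    single keys; keys outside [K] carry coefficient 0. *)
Lemma lin_keyed (keyT : eqType) (key : nmon -> keyT) (K : seq keyT) (H : keyT -> F) psi f :
  (forall p, List.In p f -> psi p.2 = H (key p.2)) ->
  (forall x, x \notin K -> H x = 0) ->
  (forall x, x \in K -> lin (fun u => (key u == x)%:R) f = 0) ->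
  lin psi f = 0.
Proof.
move=> hpsi hH hK; rewrite (eq_lin (psi' := fun u => \sum_(x <- undup K) H x * (key u == x)%:R)).
  rewrite /lin; under eq_bigr do rewrite mulr_sumr; rewrite exchange_big /=.
  rewrite big_seq; apply: big1 => x; rewrite mem_undup => /hK e.
  transitivity (H x * lin (fun u => (key u == x)%:R) f); last by rewrite e mulr0.
  by rewrite /lin mulr_sumr; apply: eq_bigr => p _; rewrite mulrCA.
move=> p /hpsi ->; have [kK|/[dup] kK /hH ->] := boolP (key p.2 \in K).
  rewrite (bigD1_seq (key p.2)) ?undup_uniq ?mem_undup //= eqxx mulr1 big1 ?addr0 //.
  by move=> x /negbTE; rewrite eq_sym => ->; rewrite mulr0.
rewrite big_seq big1 // => x; rewrite mem_undup => xK.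
by case: eqP => [e|]; rewrite ?mulr0 //; move: kK; rewrite e xK.
Qed.

End Codimension.

(** * Values of monomials in A and in its unital extension *)

Section Evaluation.
Variables (F : fieldType) (m : nat) (w : nat -> bool).
Hypothesis m2 : (2 <= m)%N.
Local Open Scope ring_scope.

Notation pos := (path_pos m w).
Notation letter := (path_letter m w).
Notation fact := (factor m w).

Definition path_sym t := Sz (pos t).1 (pos t).2.

Lemma vmul_path0 (u v : vecA F) : vmul m w u v (path_sym 0) = 0.
Proof. by []. Qed.

Lemma vmul_pathS (u v : vecA F) t :
  vmul m w u v (path_sym t.+1) = u (path_sym t) * v (if letter t then Sb else Sa).
Proof.
rewrite /path_sym /path_letter /path_pos iterS -/(pos t).
have := path_pos_valid w m2 t; case: (pos t) => i j /= /and3P [h1 h2 h3].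
rewrite /next_pos /=; case: (ltnP j (len m w i)) => h /=; first by rewrite h1 /= ltnS h2 h.
rewrite !ltnS h1 /=; have -> // : j = len m w i; lia.
Qed.

Lemma vmul_off (u v : vecA F) e : (forall t, path_sym t <> e) -> vmul m w u v e = 0.
Proof.
case: e => // i j off /=.
have contra : (1 <= i)%N -> (1 <= j <= len m w i)%N -> False.
  by move=> i1 /(path_pos_surj m2 i1) [t et]; apply: (off t); rewrite /path_sym et.
case: ifP => [/andP [i1 /andP [j2 jl]]|_].
  by case: contra => //; rewrite jl (ltnW j2).
case: ifP => // /andP [i2 /eqP j1]; case: contra; first exact: ltnW.
by rewrite j1 /=; apply: ltnW; apply: len_ge2.
Qed.

Definition kind (v : gvar) : bool := if v is inr _ then true else false.

Definition gen_sym (v : gvar) : sym := if kind v then Sb else Sa.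

Definition graded (s : gvar -> vecAs F) := graded_subst (B := Amw_unital F m w) s.

Lemma graded_gen s v b : graded s ->
  (s v).2 (if b then Sb else Sa) = if b == kind v then (s v).2 (gen_sym v) else 0.
Proof.
move=> [he ho]; case: v => i; rewrite /gen_sym /=.
  by have [_ [h _]] := he i; case: b.
by have [_ [_ [h _]]] := ho i; case: b.
Qed.

(** Each step back along the path reads one variable at the generator labelling the edge. Even
    elements have no b-coordinate and odd ones no a-coordinate, so the parities of [p] must spell
    the factor leading to vertex [t]. *)
Lemma foldl_vmul_path (s : gvar -> vecAs F) u p t : graded s ->
  foldl (vmul m w) u [seq (s v).2 | v <- p] (path_sym t) =
  if (size p <= t)%N && (fact (t - size p) (size p) == map kind p)
  then u (path_sym (t - size p)) * \prod_(v <- p) (s v).2 (gen_sym v) else 0.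
Proof.
move=> gs; elim/last_ind: p t => [|p v IH] t.
  by rewrite big_nil mulr1 subn0.
rewrite map_rcons foldl_rcons size_rcons.
case: t => [|t]; first exact: vmul_path0.
rewrite vmul_pathS IH subSS ltnS factor_rcons map_rcons eqseq_rcons.
case: (leqP (size p) t) => h /=; last by rewrite mul0r.
rewrite subnK // graded_gen // -cats1 big_cat big_seq1 /=.
by case: eqP => _ /=; rewrite ?mul0r //; case: eqP => _; rewrite ?mulr0 // mulrA.
Qed.

Lemma foldl_vmul_off u (p : seq (vecA F)) e :
  (forall t, path_sym t <> e) -> p <> [::] -> foldl (vmul m w) u p e = 0.
Proof. by move=> off; case/lastP: p => // p x _; rewrite foldl_rcons vmul_off. Qed.

(** A proper product has no coordinate at a or b, so it annihilates from the right: this is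
    [x (y z) = 0]. *)
Lemma vmul_foldl0 (u v : vecA F) (p : seq (vecA F)) :
  p <> [::] -> vmul m w u (foldl (vmul m w) v p) = vzero F.
Proof.
case/lastP: p => // p x _; rewrite foldl_rcons.
by apply: functional_extensionality => -[||i j] //=; rewrite !mulr0 !if_same.
Qed.

Definition one : vecAs F := (1, vzero F).

Definition ev (s : gvar -> vecAs F) (u : nmon) : vecAs F :=
  mon_eval (B := Amw_unital F m w) s u.

Lemma evM s u1 u2 : ev s (MMul u1 u2) = smul m w (ev s u1) (ev s u2).
Proof. by []. Qed.

Lemma vmul0 u : vmul m w u (vzero F) = vzero F.
Proof. by apply: functional_extensionality => -[||i j] //=; rewrite !mulr0 !if_same. Qed.

Lemma vmul0l u : vmul m w (vzero F) u = vzero F.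
Proof. by apply: functional_extensionality => -[||i j] //=; rewrite !mul0r !if_same. Qed.

Lemma smul1 x : smul m w x one = x.
Proof.
case: x => a u; rewrite /smul /one /= mulr1 vmul0; congr pair.
by apply: functional_extensionality => e; rewrite /vadd /vscale /vzero mulr0 mul1r addr0 add0r.
Qed.

Lemma smul1l x : smul m w one x = x.
Proof.
case: x => a u; rewrite /smul /one /= mul1r vmul0l; congr pair.
by apply: functional_extensionality => e; rewrite /vadd /vscale /vzero mulr0 mul1r !addr0.
Qed.

Lemma smul_aug (u v : vecA F) : smul m w (0, u) (0, v) = (0, vmul m w u v).
Proof.
rewrite /smul /= mulr0; congr pair.
by apply: functional_extensionality => e; rewrite /vadd /vscale !mul0r !add0r.
Qed.

(* Normal form of a monomial once the variables outside [keep] have been replaced by 1: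
   the unit, a left-normed word with its first letter separated, or zero. *)
Inductive nform := NUnit | NWord of gvar & seq gvar | NZero.

Fixpoint nf (keep : pred gvar) (u : nmon) : nform :=
  match u with
  | MVar v => if keep v then NWord v [::] else NUnit
  | MMul u1 u2 =>
    match nf keep u1, nf keep u2 with
    | NUnit, r => r
    | r, NUnit => r
    | NWord v p, NWord v' [::] => NWord v (rcons p v')
    | _, _ => NZero
    end
  end.

Definition nf_eval (s : gvar -> vecAs F) (r : nform) : vecAs F :=
  match r with
  | NUnit => one
  | NWord v p => (0, foldl (vmul m w) (s v).2 [seq (s x).2 | x <- p])
  | NZero => szero F
  end.

Definition pure_on (keep : pred gvar) (s : gvar -> vecAs F) v :=
  if keep v then (s v).1 = 0 else s v = one.

Lemma ev_nf keep s u : (forall v, v \in leaves u -> pure_on keep s v) ->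
  ev s u = nf_eval s (nf keep u).
Proof.
elim: u => [v|u1 IH1 u2 IH2] h.
  have := h v (mem_head _ _); rewrite /pure_on /ev /=; case: ifP => //= _.
  by case: (s v) => a x /= ->.
rewrite evM IH1 ?IH2 /=; try by move=> v hv; apply: h; rewrite /= mem_cat hv ?orbT.
have Z0 r : smul m w (szero F) (nf_eval s r) = szero F \/ r = NUnit.
  by case: r => [|v p|]; [right|left|left]; rewrite ?smul_aug // vmul0l.
case: (nf keep u1) => [|v p|]; first by rewrite smul1l.
  case: (nf keep u2) => [|v' [|x p']|] /=; rewrite ?smul1 ?smul_aug //.
  - by rewrite map_rcons foldl_rcons.
  - have -> : foldl (vmul m w) (vmul m w (s v').2 (s x).2) [seq (s y).2 | y <- p'] =
      foldl (vmul m w) (s v').2 [seq (s y).2 | y <- x :: p'] by [].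
    by rewrite vmul_foldl0.
  - by rewrite vmul0.
case: (Z0 (nf keep u2)) => [->|->]; last by rewrite smul1.
by case: (nf keep u2).
Qed.

Lemma nf_vars keep u :
  match nf keep u with
  | NUnit => filter keep (leaves u) = [::]
  | NWord v p => filter keep (leaves u) = v :: p
  | NZero => filter keep (leaves u) <> [::]
  end.
Proof.
elim: u => [v|u1 IH1 u2 IH2] /=; first by case: ifP.
rewrite filter_cat; case: (nf keep u1) IH1 => [->|v p ->|]; first by [].
  by case: (nf keep u2) IH2 => [->|v' [|x q] ->|]; rewrite ?cats0 // -cats1.
by case: (filter keep (leaves u1)) => // v p _; case: (nf keep u2).
Qed.

(** Past the first variable only parities are recorded: the values enter through a product of
    scalars, where order does not matter. *)
Definition key keep u : option (gvar * seq bool) :=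
  if nf keep u is NWord v p then Some (v, map kind p) else None.

(* Coordinates of an element of the unital algebra: [None] is the coefficient of 1. *)
Definition coord (e : option sym) (x : vecAs F) : F := if e is Some e then x.2 e else x.1.

Lemma coord0 x : (forall e, coord e x = 0) -> x = szero F.
Proof.
case: x => a u h; congr pair; first exact: (h None).
by apply: functional_extensionality => e; apply: (h (Some e)).
Qed.

Definition pev (s : gvar -> vecAs F) f : vecAs F := poly_eval (B := Amw_unital F m w) s f.

Lemma coord_pev e s f : coord e (pev s f) = lin (fun u => coord e (ev s u)) f.
Proof.
rewrite /lin; elim: f => [|p f IH]; first by rewrite big_nil; case: e.
by rewrite big_cons -IH; case: (e).
Qed.

(** A sits in its unital extension as the elements of scalar part 0, so one analysis serves both
    algebras. *)
Lemma ev_aug (s : gvar -> vecA F) u :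
  ev (fun v => (0, s v)) u = (0, mon_eval (B := Amw F m w) s u).
Proof. by elim: u => [//|u1 IH1 u2 IH2]; rewrite evM IH1 IH2 smul_aug. Qed.

Lemma pev_aug (s : gvar -> vecA F) f :
  pev (fun v => (0, s v)) f = (0, poly_eval (B := Amw F m w) s f).
Proof.
elim: f => [//|p f IH]; rewrite /pev /= -/(pev _ f) IH.
rewrite -/(ev (fun v => (0, s v)) p.2) ev_aug /sadd /sscale /=.
by rewrite mulr0 addr0.
Qed.

(** * Tests for vanishing under substitutions by 1 or by elements of A *)

Section Vanishing.
Variables (keep : pred gvar) (s : gvar -> vecAs F) (k l : nat).
Hypothesis gs : graded s.
Hypothesis ps : forall v, v \in mvars k l -> pure_on keep s v.

Let kept := filter keep (mvars k l).

Lemma kept_key (f : npoly F) p : in_P k l f -> List.In p f ->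
  perm_eq (filter keep (leaves p.2)) kept.
Proof. by move=> hf /hf; apply: perm_filter. Qed.

Lemma pure_leaves (f : npoly F) p : in_P k l f -> List.In p f ->
  forall v, v \in leaves p.2 -> pure_on keep s v.
Proof. by move=> hf /hf /perm_mem h v; rewrite h; apply: ps. Qed.

(** The scalar part of a monomial is 1 if no variable is kept and 0 otherwise, the same for all
    monomials of [f]. *)
Lemma lin_scalar0 f : in_P k l f -> lin (fun=> 1) f = 0 ->
  lin (fun u => coord None (ev s u)) f = 0.
Proof.
move=> hf h1; have [e|ne] := eqVneq kept [::].
  rewrite -{}h1; apply: eq_lin => p hp; rewrite (ev_nf (pure_leaves hf hp)).
  have := kept_key hf hp; rewrite e => /perm_nilP.
  by move: (nf_vars keep p.2); case: (nf keep p.2) => //= v q ->.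
transitivity (lin (fun=> 0) f).
  apply: eq_lin => p hp; rewrite (ev_nf (pure_leaves hf hp)).
  have := kept_key hf hp.
  move: (nf_vars keep p.2); case: (nf keep p.2) => //= -> .
  by rewrite perm_sym => /perm_nilP e; rewrite e in ne.
by rewrite /lin; apply: big1 => p _; rewrite mulr0.
Qed.

(** On the monomials of [f] a coordinate is a function of the key, so [lin_keyed] applies. It
    vanishes unless the key carries a factor of the path word with the right number of odd
    variables, and [K] contains those keys. *)
Lemma lin_coord0 (K : seq (gvar * seq bool)) f e :
  in_P k l f ->
  (forall v t, v \in kept ->
     count id (kind v :: fact t (size kept).-1) = count kind kept ->
     (v, fact t (size kept).-1) \in K) ->
  (forall x, x \in K -> lin (fun u => (key keep u == Some x)%:R) f = 0) ->
  lin (fun u => coord (Some e) (ev s u)) f = 0.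
Proof.
move=> hf hK h0.
(* Every word key of a monomial of [f] is [ok]; other keys get coefficient 0. *)
pose ok v (x : seq bool) := [&& v \in kept, size x == (size kept).-1 &
  count id (kind v :: x) == count kind kept].
pose nw v (x : seq bool) (g : F) := if ok v x then g else 0.
pose W v := \prod_(x <- rem v kept) (s x).2 (gen_sym x).
have keyP p : List.In p f ->
  match nf keep p.2 with
  | NWord v q => [/\ ok v (map kind q), perm_eq q (rem v kept) & key keep p.2 = Some (v, map kind q)]
  | _ => key keep p.2 = None
  end.
  move=> hp; have := kept_key hf hp; move: (nf_vars keep p.2); rewrite /key.
  case: (nf keep p.2) => // v q -> pq; have vk : v \in kept by rewrite -(perm_mem pq) mem_head.
  split=> //; last by rewrite -(perm_cons v) (permPl pq) perm_to_rem.
  rewrite /ok vk size_map -(perm_size pq) eqxx /= count_map.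
  by rewrite -(permP pq) /= eqxx.
have inK H : (forall v x, ok v x -> (forall t, fact t (size kept).-1 <> x) -> H v x = 0) ->
  forall y : option (gvar * seq bool), y \notin map Some K ->
  (if y is Some (v, x) then nw v x (H v x) else 0) = 0.
  move=> hH [[v x]|//] nK; rewrite /nw; case: ifP => // o; apply: hH => // t e'.
  move/negP: nK; apply; apply: map_f; have /and3P [vk /eqP sx /eqP cx] := o.
  by rewrite -e'; apply: hK => //; rewrite e'.
have h0' x : x \in map Some K -> lin (fun u => (key keep u == x)%:R) f = 0.
  by case/mapP => y yK ->; apply: h0.
have [[t et]|off] := excluded_middle_informative (exists t, path_sym t = e).
  pose H v x := if (size x <= t)%N && (fact (t - size x) (size x) == x)
    then (s v).2 (path_sym (t - size x)) * W v else 0.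
  apply: (lin_keyed (key := key keep)
    (H := fun y => if y is Some (v, x) then nw v x (H v x) else 0) _ _ h0').
  - move=> p hp; rewrite (ev_nf (pure_leaves hf hp)); have := keyP p hp.
    case: (nf keep p.2) => [->//|v q [okv pq ->]|->//].
    rewrite /= /nw okv -et foldl_vmul_path // /H size_map; case: ifP => // _.
    by rewrite (perm_big _ pq).
  - apply: inK => v x /and3P [_ /eqP sx _] nf'; rewrite /H.
    by case: ifP => // /andP [_ /eqP e']; case: (nf' (t - size x)%N); rewrite -sx.
have off' t : path_sym t <> e by move=> e'; apply: off; exists t.
(* Off the path all proper products vanish, so only words of a single kept variable contribute. *)
pose H v (x : seq bool) := if x is [::] then (s v).2 e else 0.
apply: (lin_keyed (key := key keep)
    (H := fun y => if y is Some (v, x) then nw v x (H v x) else 0) _ _ h0').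
- move=> p hp; rewrite (ev_nf (pure_leaves hf hp)); have := keyP p hp.
  case: (nf keep p.2) => [->//|v q [okv pq ->]|->//].
  rewrite /= /nw okv /H; case: q okv pq => // x q _ _.
  by rewrite foldl_vmul_off.
- apply: inK => v [|//] /and3P [_ /eqP sx _] nf'.
  by case: (nf' 0%N); rewrite -sx.
Qed.

End Vanishing.
End Evaluation.

(** * Upper bounds for the codimensions *)

Section UpperBounds.
Variables (F : fieldType) (m : nat) (w : nat -> bool).
Hypothesis m2 : (2 <= m)%N.
Local Open Scope ring_scope.

Notation ev := (ev (F := F) m w).
Notation pev := (pev (F := F) m w).
Notation graded := (graded (F := F) m w).
Notation one := (one F).

Lemma vmul_linr (x y z : vecA F) a :
  vmul m w x (vadd y (vscale a z)) = vadd (vmul m w x y) (vscale a (vmul m w x z)).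
Proof.
apply: functional_extensionality => -[||i j]; rewrite /vadd /vscale /=; try by ring.
by case: ((0 < i) && _)%N; [ring|case: ((1 < i) && _)%N; ring].
Qed.

Lemma vmul_linl (x y z : vecA F) a :
  vmul m w (vadd y (vscale a z)) x = vadd (vmul m w y x) (vscale a (vmul m w z x)).
Proof.
apply: functional_extensionality => -[||i j]; rewrite /vadd /vscale /=; try by ring.
by case: ((0 < i) && _)%N; [ring|case: ((1 < i) && _)%N; ring].
Qed.

Lemma smul_linr (x y z : vecAs F) a :
  smul m w x (sadd y (sscale a z)) = sadd (smul m w x y) (sscale a (smul m w x z)).
Proof.
rewrite /smul /sadd /sscale /= vmul_linr; congr pair; first by ring.
by apply: functional_extensionality => e; rewrite /vadd /vscale; ring.
Qed.

Lemma smul_linl (x y z : vecAs F) a :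
  smul m w (sadd y (sscale a z)) x = sadd (smul m w y x) (sscale a (smul m w z x)).
Proof.
rewrite /smul /sadd /sscale /= vmul_linl; congr pair; first by ring.
by apply: functional_extensionality => e; rewrite /vadd /vscale; ring.
Qed.

Definition upd (s : gvar -> vecAs F) v x : gvar -> vecAs F := fun y => if y == v then x else s y.

Lemma eq_ev s s' u : {in leaves u, s =1 s'} -> ev s u = ev s' u.
Proof.
elim: u => [v|u1 IH1 u2 IH2] h; first by apply: h; rewrite mem_head.
by rewrite !evM IH1 ?IH2 // => v hv; apply: h; rewrite /= mem_cat hv ?orbT.
Qed.

Lemma ev_upd_id s v x u : v \notin leaves u -> ev (upd s v x) u = ev s u.
Proof. by move=> vu; apply: eq_ev => y yu; rewrite /upd; case: eqP => // e; rewrite -e yu in vu. Qed.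

(** A variable occurring once enters linearly, and its value splits into a part in A and a multiple
    of 1. *)
Lemma ev_upd_split s v u : count_mem v (leaves u) = 1%N ->
  ev s u = sadd (ev (upd s v (0, (s v).2)) u) (sscale (s v).1 (ev (upd s v one) u)).
Proof.
elim: u => [y|u1 IH1 u2 IH2].
  rewrite /=; case: eqP => // -> _; rewrite /ev /= /upd eqxx; case: (s v) => a x.
  rewrite /sadd /sscale /=; congr pair; first by ring.
  by apply: functional_extensionality => e; rewrite /vadd /vscale /vzero; ring.
rewrite [leaves _]/= count_cat !evM => h.
have [h1|h1] := posnP (count_mem v (leaves u1)).
  rewrite h1 in h; have n1 : v \notin leaves u1 by rewrite -has_pred1 has_count h1.
  by rewrite {1}IH2 // !(ev_upd_id _ _ n1) smul_linr.
have h2 : count_mem v (leaves u2) = 0%N by lia.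
have n2 : v \notin leaves u2 by rewrite -has_pred1 has_count h2.
by rewrite {1}IH1; [rewrite !(ev_upd_id _ _ n2) smul_linl|lia].
Qed.

Lemma mvars_uniq k l : uniq (mvars k l).
Proof.
rewrite cat_uniq !map_inj_uniq ?iota_uniq /=; try by move=> x y [].
by rewrite andbT; apply/hasPn => v /mapP [i _ ->]; apply/negP => /mapP [].
Qed.

Lemma mem_mvars_inl k l i : (inl i \in mvars k l) = (1 <= i <= k)%N.
Proof.
rewrite mem_cat mem_map; last by move=> x y [].
by rewrite mem_iota add1n ltnS; case: (boolP (inl i \in [seq _ | _ <- _])) => [/mapP []|]; rewrite ?orbF.
Qed.

Lemma evenA_vzero : evenA m w (vzero F).
Proof. by split=> //; split=> [e|]; [rewrite eqxx|exists 0%N]. Qed.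

Lemma graded_upd s i x : graded s -> evenA m w x.2 -> graded (upd s (inl i) x).
Proof. by case=> he ho hx; split=> j; rewrite /upd; [case: (inl j == inl i :> gvar); [exact: hx|exact: he]|exact: ho]. Qed.

Lemma pure_identity k l f : in_P k l f ->
  (forall s, graded s ->
     (forall i, (1 <= i <= k)%N -> (s (inl i)).1 = 0 \/ s (inl i) = one) ->
     pev s f = szero F) ->
  is_gr_identity (Amw_unital F m w) f.
Proof.
move=> hf h0.
(* [r] counts the leading even variables whose values are still arbitrary; each induction step
   splits the value of the last of them. *)
have H r : (r <= k)%N -> forall s, graded s ->
   (forall i, (r < i <= k)%N -> (s (inl i)).1 = 0 \/ s (inl i) = one) -> pev s f = szero F.
  elim: r => [_|r IH rk] s gs hs; first exact: h0.
  have hu x : evenA m w x.2 -> x.1 = 0 \/ x = one -> pev (upd s (inl r.+1) x) f = szero F.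
    move=> xe hx; apply: IH; [exact: ltnW|exact: graded_upd|].
    move=> i hi; rewrite /upd; case: (inl i =P inl r.+1 :> gvar) => [_|ne]; first exact: hx.
    have : i <> r.+1 by move=> e; apply: ne; rewrite e.
    by move=> ne'; apply: hs; lia.
  have h1 := hu (0, (s (inl r.+1)).2) (gs.1 _) (or_introl erefl).
  have h2 := hu one evenA_vzero (or_intror erefl).
  apply: coord0 => e; rewrite coord_pev.
  rewrite (eq_lin (psi' := fun u => coord e (ev (upd s (inl r.+1) (0, (s (inl r.+1)).2)) u)
    + (s (inl r.+1)).1 * coord e (ev (upd s (inl r.+1) one) u))); last first.
    move=> p hp; rewrite (@ev_upd_split s (inl r.+1)); first by case: e.
    rewrite (permP (hf p hp)) count_uniq_mem ?mvars_uniq // mem_mvars_inl /=.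
    by rewrite rk.
  transitivity (coord e (szero F) + (s (inl r.+1)).1 * coord e (szero F)).
    rewrite -[in X in _ = X + _]h1 -h2 !coord_pev /lin mulr_sumr -big_split /=.
    by apply: eq_bigr => p _; ring.
  by have -> : coord e (szero F) = 0; [case: (e)|rewrite mulr0 addr0].
move=> s gs; apply: (H k (leqnn k) s gs) => i; lia.
Qed.

Variables (C : nat) (Pat : nat -> seq (seq bool)).
Hypothesis size_Pat : forall n, (size (Pat n) <= C * n.+1)%N.
Hypothesis mem_Pat : forall t n, factor m w t n \in Pat n.

(** There are [q] choices of the first variable and at most [C * q.+1] patterns for the others. The
    threshold is one above the maximal count because the first variable labels no edge and may
    itself be odd. *)
Definition word_bound q l := if (l <= (max_count m w q).+1)%N then (q * (C * q.+1))%N else 0%N.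

Definition keys (kept : seq gvar) : seq (gvar * seq bool) :=
  if (count kind kept <= (max_count m w (size kept)).+1)%N
  then [seq (v, x) | v <- kept, x <- Pat (size kept).-1] else [::].

Lemma size_keys kept : (size (keys kept) <= word_bound (size kept) (count kind kept))%N.
Proof.
rewrite /keys /word_bound; case: ifP => // _.
rewrite size_allpairs leq_mul2l; apply/orP; right; apply: leq_trans (size_Pat _) _.
by rewrite leq_mul2l; apply/orP; right; lia.
Qed.

Lemma mem_keys kept v t : v \in kept ->
  count id (kind v :: factor m w t (size kept).-1) = count kind kept ->
  (v, factor m w t (size kept).-1) \in keys kept.
Proof.
move=> vk /= hc; rewrite /keys ifT; first by apply: allpairs_f.
rewrite -hc -add1n leq_add ?leq_b1 //.
apply: leq_trans (count_le_max _ _ _ _) _; case: (size kept) => // n.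
by have /andP [] := max_countS w m2 n.
Qed.

Definition key_test keep (x : gvar * seq bool) : nmon -> F :=
  fun u => (key keep u == Some x)%:R.

Lemma key_tests_coord0 (keep : pred gvar) k l s f :
  in_P k l f -> graded s -> (forall v, v \in mvars k l -> pure_on keep s v) ->
  (forall psi, List.In psi [seq key_test keep x | x <- keys (filter keep (mvars k l))] ->
     lin psi f = 0) ->
  forall e, coord (Some e) (pev s f) = 0.
Proof.
move=> hf gs ps h e; rewrite coord_pev.
apply: (lin_coord0 m2 gs ps (K := keys (filter keep (mvars k l)))) => //.
  by move=> v t vk; apply: mem_keys.
move=> x; move: h; elim: (keys _) => //= y K IH h.
rewrite inE => /orP [/eqP ->|xK]; first by apply: (h (key_test keep y)); left.
by apply: IH => // psi hpsi; apply: h; right.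
Qed.

Lemma count_kind_mvars k l : count kind (mvars k l) = l.
Proof. by rewrite count_cat !count_map /= count_pred0 count_predT size_iota. Qed.

Lemma Amw_tests k l : exists2 psis : seq (nmon -> F),
  (size psis <= word_bound (k + l) l)%N &
  forall f, in_P k l f -> (forall psi, List.In psi psis -> lin psi f = 0) ->
     is_gr_identity (Amw F m w) f.
Proof.
exists [seq key_test predT x | x <- keys (filter predT (mvars k l))].
  rewrite size_map filter_predT; apply: leq_trans (size_keys _) _.
  by rewrite count_kind_mvars size_cat !size_map !size_iota.
move=> f hf h s [he ho].
have gs : graded (fun v => (0, s v)) by split=> i; [apply: he|split=> //; apply: ho].
have := key_tests_coord0 (keep := predT) hf gs (fun _ _ => erefl) h.
by rewrite pev_aug /= => e; apply: functional_extensionality.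
Qed.

(** Variables are numbered from 1 and ordinals from 0. Odd variables are always kept, since odd
    elements have scalar part 0. *)
Definition in_set k (T : {set 'I_k}) : pred gvar :=
  fun v => if v is inl i then [exists t : 'I_k, (t \in T) && (t.+1 == i)] else true.

Lemma in_set_ord k (T : {set 'I_k}) (t : 'I_k) : in_set T (inl t.+1) = (t \in T).
Proof.
apply/existsP/idP => [[t' /andP [tT /eqP [/val_inj <-]]] //|tT].
by exists t; rewrite tT eqxx.
Qed.

Lemma filter_in_set k l (T : {set 'I_k}) :
  filter (in_set T) (mvars k l) = [seq inl (val t).+1 | t <- enum T] ++ [seq inr i | i <- iota 1 l].
Proof.
rewrite filter_cat; congr cat; last by apply/all_filterP/allP => v /mapP [i _ ->].
have eT : enum T = filter (mem T) (enum 'I_k) by rewrite enumT.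
have : iota 1 k = [seq (val t).+1 | t <- enum 'I_k].
  by rewrite (map_comp succn val) val_enum_ord -[1%N]addn0 iotaDl.
rewrite {}eT => ->; elim: (enum 'I_k) => //= t ts IH.
by have := in_set_ord T t; rewrite /= IH => ->; case: (t \in T).
Qed.

(** One batch of key tests for each set of even variables not replaced by 1; the constant functional
    controls the scalar part. *)
Lemma Amw_unital_tests k l : exists2 psis : seq (nmon -> F),
  (size psis <= 1 + \sum_(T : {set 'I_k}) word_bound (#|T| + l) l)%N &
  forall f, in_P k l f -> (forall psi, List.In psi psis -> lin psi f = 0) ->
     is_gr_identity (Amw_unital F m w) f.
Proof.
pose tests (T : {set 'I_k}) := [seq key_test (in_set T) x | x <- keys (filter (in_set T) (mvars k l))].
exists ((fun=> 1) :: flatten [seq tests T | T <- enum {set 'I_k}]).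
  rewrite /= -addn1 addnC leq_add2l size_flatten /shape -map_comp sumnE big_map big_enum /=.
  apply: leq_sum => T _; rewrite /= size_map; apply: leq_trans (size_keys _) _.
  rewrite filter_in_set size_cat !size_map size_iota -cardE count_cat !count_map.
  by rewrite (eq_count (a2 := pred0)) // count_pred0 count_predT size_iota.
move=> f hf h; apply: (pure_identity hf) => s gs hs.
pose T := [set t : 'I_k | (s (inl t.+1)).1 == 0].
have ps v : v \in mvars k l -> pure_on (in_set T) s v.
  case: v => i; last by move=> _; rewrite /pure_on /=; have [] := gs.2 i.
  rewrite mem_mvars_inl => /andP [i1 ik]; rewrite /pure_on.
  have hi : (i.-1 < k)%N by lia.
  have -> : in_set T (inl i) = ((s (inl i)).1 == 0).
    by have := in_set_ord T (Ordinal hi); rewrite /= prednK // => ->; rewrite inE /= prednK.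
  by case: eqP => // ne; case: (hs i) => //; rewrite i1.
apply: coord0 => -[e|].
  apply: (key_tests_coord0 hf gs ps) => psi hpsi; apply: h; right.
  have: T \in enum {set 'I_k} by rewrite mem_enum.
  elim: (enum _) => //= U Us IH; rewrite inE => /orP [/eqP <-|/IH hin].
    by apply/List.in_or_app; left.
  by apply/List.in_or_app; right.
rewrite coord_pev.
by apply: (lin_scalar0 _ _ ps hf); apply: h; left.
Qed.

End UpperBounds.

(** * Lower bounds for the codimensions *)

Section LowerBounds.
Variables (F : fieldType) (m : nat) (w : nat -> bool).
Hypothesis m2 : (2 <= m)%N.
Local Open Scope ring_scope.

Notation ev := (ev (F := F) m w).
Notation pev := (pev (F := F) m w).
Notation graded := (graded (F := F) m w).
Notation one := (one F).
Notation pos := (path_pos m w).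

Definition poly_mulr (f : npoly F) v : npoly F := [seq (p.1, MMul p.2 (MVar v)) | p <- f].

Definition poly_comm (f : npoly F) v : npoly F :=
  poly_mulr f v ++ [seq (- p.1, MMul (MVar v) p.2) | p <- f].

(* The commutators kill every substitution putting 1 for v or a letter of L; on the
   substitutions v := z, L_i := a or b they reduce to the product v L_1 L_2 ..., because
   a z = b z = 0. *)
Definition comm_word v L R : npoly F :=
  foldl poly_mulr (foldl poly_comm [:: (1, MVar v)] L) R.

Lemma pev_cons s p f : pev s (p :: f) = sadd (sscale p.1 (ev s p.2)) (pev s f).
Proof. by []. Qed.

Lemma pev_cat s f g : pev s (f ++ g) = sadd (pev s f) (pev s g).
Proof.
elim: f => [|p f IH]; last first.
  rewrite cat_cons !pev_cons IH /sadd /=; congr pair; first by ring.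
  by apply: functional_extensionality => e; rewrite /vadd; ring.
case: (pev s g) => a u; rewrite /sadd /= add0r; congr pair.
by apply: functional_extensionality => e; rewrite /vadd /vzero add0r.
Qed.

Lemma smul0l x : smul m w (szero F) x = szero F.
Proof.
rewrite /smul /= vmul0l; congr pair; first by ring.
by apply: functional_extensionality => e; rewrite /vadd /vscale /vzero; ring.
Qed.

Lemma smul0r x : smul m w x (szero F) = szero F.
Proof.
rewrite /smul /= vmul0; congr pair; first by ring.
by apply: functional_extensionality => e; rewrite /vadd /vscale /vzero; ring.
Qed.

Lemma saddC (x y : vecAs F) : sadd x y = sadd y x.
Proof.
rewrite /sadd; congr pair; first by ring.
by apply: functional_extensionality => e; rewrite /vadd; ring.
Qed.

Lemma pev_mulr s f v : pev s (poly_mulr f v) = smul m w (pev s f) (s v).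
Proof.
elim: f => [|p f IH]; first by rewrite smul0l.
by rewrite pev_cons [poly_mulr _ _]/= pev_cons IH saddC [in RHS]saddC smul_linl.
Qed.

Lemma pev_opp_mull s f v :
  pev s [seq (- p.1, MMul (MVar v) p.2) | p <- f] = sscale (-1) (smul m w (s v) (pev s f)).
Proof.
elim: f => [|p f IH].
  by rewrite smul0r; symmetry; apply: coord0 => -[e|]; rewrite /= /vscale ?mulr0.
rewrite [map _ _]/= !pev_cons IH saddC [in RHS]saddC smul_linr evM /=.
set x := smul m w _ _; set y := smul m w _ (ev s p.2).
rewrite /sscale /sadd /=; congr pair; first by ring.
by apply: functional_extensionality => e; rewrite /vadd /vscale; ring.
Qed.

Lemma pev_comm s f v :
  pev s (poly_comm f v) =
  sadd (smul m w (pev s f) (s v)) (sscale (-1) (smul m w (s v) (pev s f))).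
Proof. by rewrite pev_cat pev_mulr pev_opp_mull. Qed.

Lemma saddNx (x : vecAs F) : sadd x (sscale (-1) x) = szero F.
Proof.
rewrite /sscale /sadd /=; congr pair; first by ring.
by apply: functional_extensionality => e; rewrite /vadd /vscale /vzero; ring.
Qed.

Lemma pev_comm_one s f v : pev s f = one \/ s v = one -> pev s (poly_comm f v) = szero F.
Proof. by rewrite pev_comm => -[->|->]; rewrite smul1 smul1l saddNx. Qed.

Lemma pev_comm0 s f v : pev s f = szero F -> pev s (poly_comm f v) = szero F.
Proof. by rewrite pev_comm => ->; rewrite smul0l smul0r saddNx. Qed.

Lemma pev_var s v : pev s [:: (1, MVar v)] = s v.
Proof.
rewrite pev_cons /pev /=; case: (s v) => a u; rewrite /sscale /sadd /=; congr pair; first by ring.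
by apply: functional_extensionality => e; rewrite /vadd /vscale /vzero; ring.
Qed.

(** The list [x :: L] is nonempty because it takes a first commutator to kill the value 1 of [v]. *)
Lemma pev_comm_word0 s v x L R y : y \in v :: x :: L -> s y = one ->
  pev s (comm_word v (x :: L) R) = szero F.
Proof.
move=> yL sy; rewrite /comm_word.
have H0 L' f : pev s f = szero F -> pev s (foldl poly_comm f L') = szero F.
  by elim: L' f => //= z L' IH f hf; apply/IH/pev_comm0.
suff : pev s (foldl poly_comm [:: (1, MVar v)] (x :: L)) = szero F.
  elim: R (foldl _ _ _) => //= z R IH f hf; apply: IH.
  by rewrite pev_mulr hf smul0l.
move: yL; rewrite inE => /orP [/eqP e|yL].
  by apply: (H0 L); apply: pev_comm_one; left; rewrite pev_var -e.
elim: (x :: L) [:: (1, MVar v)] yL => //= z L' IH f; rewrite inE => /orP [/eqP e|/IH //].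
by apply: H0; apply: pev_comm_one; right; rewrite -e.
Qed.

Lemma in_P_comm_word k l v L R : perm_eq (v :: L ++ R) (mvars k l) ->
  in_P k l (comm_word v L R).
Proof.
move=> h; suff H p : List.In p (comm_word v L R) -> perm_eq (leaves p.2) (v :: L ++ R).
  by move=> p /H /perm_trans; apply.
rewrite /comm_word -[v :: L ++ R]/(([:: v] ++ L) ++ R).
pose Q ls (f : npoly F) := forall p, List.In p f -> perm_eq (leaves p.2) ls.
have Qmul ls f x : Q ls f -> Q (rcons ls x) (poly_mulr f x).
  move=> hf q /List.in_map_iff [r [<- /hf hr]] /=.
  by rewrite -cats1 perm_cat2r.
have Qcomm ls f x : Q ls f -> Q (rcons ls x) (poly_comm f x).
  move=> hf q /(@List.in_app_or _ _ _ q) [|]; first by apply: (Qmul _ _ _ hf).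
  move=> /List.in_map_iff [r [<- /hf hr]] /=.
  by rewrite perm_sym perm_rcons perm_cons perm_sym.
have QR ls f : Q ls f -> Q (ls ++ R) (foldl poly_mulr f R).
  elim: R ls f {h} => [|x R IH] ls f hf; first by rewrite cats0.
  by rewrite -cat_rcons; apply/IH/Qmul.
have QL ls f : Q ls f -> Q (ls ++ L) (foldl poly_comm f L).
  elim: L ls f {h} => [|x L' IH] ls f hf; first by rewrite cats0.
  by rewrite -cat_rcons; apply/IH/Qcomm.
by move: p; apply/QR/QL => q [<-|].
Qed.

Definition unit_z i j : vecA F := fun e => if e is Sz i' j' then ((i' == i) && (j' == j))%:R else 0.

Definition unit_gen (b : bool) : vecA F :=
  fun e => match e with Sa => (~~ b)%:R | Sb => b%:R | _ => 0 end.

Lemma evenA_unit_z t : odd (pos t).1 -> evenA m w (unit_z (pos t).1 (pos t).2).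
Proof.
have /and3P [h1 h2 h3] := path_pos_valid w m2 t; move=> o; split; [split|split=> //].
- move=> [||i j] /=; rewrite ?eqxx //; case: (i =P _) => [->|_]; last by rewrite /= eqxx.
  by case: (j =P _) => [->|_]; rewrite /= ?h1 ?h2 ?h3 // eqxx.
- exists (pos t).1.+1 => i j hi /=; case: (i =P _) => // e; first by move: hi; rewrite e ltnn.
- by move=> i j /=; case: (i =P _) => // ->; rewrite o.
Qed.

Lemma oddA_unit_z t : ~~ odd (pos t).1 -> oddA m w (unit_z (pos t).1 (pos t).2).
Proof.
have /and3P [h1 h2 h3] := path_pos_valid w m2 t; move=> o; split; [split|split=> //].
- move=> [||i j] /=; rewrite ?eqxx //; case: (i =P _) => [->|_]; last by rewrite /= eqxx.
  by case: (j =P _) => [->|_]; rewrite /= ?h1 ?h2 ?h3 // eqxx.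
- exists (pos t).1.+1 => i j hi /=; case: (i =P _) => // e; first by move: hi; rewrite e ltnn.
- by move=> i j /=; case: (i =P _) => // -> h; rewrite h in o.
Qed.

Lemma evenA_unit_gen : evenA m w (unit_gen false).
Proof. by split=> //; split; [move=> [||i j] //=; rewrite eqxx|exists 0%N]. Qed.

Lemma oddA_unit_gen : oddA m w (unit_gen true).
Proof. by split=> //; split; [move=> [||i j] //=; rewrite eqxx|exists 0%N]. Qed.

Lemma pev_comm_word s v L R t :
  s v = (0, unit_z (pos t).1 (pos t).2) ->
  (forall x, x \in L -> s x = (0, unit_gen (kind x))) ->
  (forall x, x \in R -> s x = one) ->
  pev s (comm_word v L R) =
  (0, foldl (vmul m w) (unit_z (pos t).1 (pos t).2) [seq (s x).2 | x <- L]).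
Proof.
move=> sv sL sR; rewrite /comm_word.
have -> f : pev s (foldl poly_mulr f R) = pev s f.
  elim: R f sR => //= x R IH f sR; rewrite IH; last by move=> y yR; apply: sR; rewrite inE yR orbT.
  by rewrite pev_mulr sR ?mem_head // smul1.
have : pev s [:: (1, MVar v)] = (0, unit_z (pos t).1 (pos t).2) by rewrite pev_var.
elim: L [:: _] (unit_z _ _) sL => //= x L IH f u sL hf; apply: IH.
  by move=> y yL; apply: sL; rewrite inE yL orbT.
rewrite pev_comm hf sL ?mem_head // !smul_aug.
have -> : vmul m w (unit_gen (kind x)) u = vzero F.
  by apply: functional_extensionality => -[||i j] //=; rewrite !mul0r !if_same.
rewrite /sadd /sscale /= mulr0 addr0; congr pair.
by apply: functional_extensionality => e; rewrite /vadd /vscale /vzero mulr0 addr0.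
Qed.

Lemma arrange_kinds (kap : seq bool) (X Y : seq gvar) :
  all (predC kind) X -> all kind Y ->
  size X = count negb kap -> size Y = count id kap ->
  exists2 L, map kind L = kap & perm_eq L (X ++ Y).
Proof.
elim: kap X Y => [|[] kap IH] X Y.
- by move=> _ _ /size0nil -> /size0nil ->; exists [::].
- case: Y => // y Y aX /andP [ky aY] sX [sY].
  have [L <- pL] := IH X Y aX aY sX sY; exists (y :: L); first by rewrite /= ky.
  by rewrite perm_sym (perm_catCA X [:: y] Y) /= perm_cons perm_sym.
- case: X => // x X /andP [kx aX] aY [sX] sY.
  have [L <- pL] := IH X Y aX aY sX sY; exists (x :: L); last by rewrite /= perm_cons.
  by rewrite /= (negbTE kx).
Qed.

Section Witness.
Variables (t n l : nat).
Hypothesis n0 : (0 < n)%N.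
(** Parities required of a word that survives from vertex [t]: the degree of the vertex itself,
    which is even in odd rows, then the edges. *)
Let kap := ~~ odd (pos t).1 :: factor m w t n.
Hypothesis lE : l = count id kap.

(** The variables of [T] and the odd ones are ordered by the parities [kap] and put into
    commutators; the remaining even variables multiply on the right and are set to 1. The clause on
    [setT] lets the same polynomial serve for A. *)
Lemma comm_word_witness k (T : {set 'I_k}) : #|T| = (n.+1 - l)%N ->
  exists f : npoly F, [/\ in_P k l f,
    forall s, (exists2 x, x \in T & s (inl (val x).+1) = one) -> pev s f = szero F &
    exists s, [/\ graded s, forall x, x \notin T -> s (inl (val x).+1) = one,
      T = setT -> forall v, (s v).1 = 0 & pev s f <> szero F]].
Proof.
move=> cT; pose R := filter (predC (in_set T)) (mvars k l).
have sk : size kap = n.+1 by rewrite /= size_factor.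
have [||||L0 hL pL] := @arrange_kinds kap [seq inl (val t).+1 | t <- enum T] [seq inr i | i <- iota 1 l].
- by rewrite all_map; apply/allP.
- by rewrite all_map; apply/allP.
- by rewrite size_map -cardE cT lE -sk -(count_predC id kap) addKn; apply: eq_count.
- by rewrite size_map size_iota.
rewrite -filter_in_set in pL.
have pLR : perm_eq (L0 ++ R) (mvars k l).
  apply: (@perm_trans _ (filter (in_set T) (mvars k l) ++ R)); first by rewrite perm_cat2r.
  by rewrite perm_filterC.
case: L0 hL pL pLR => // v L [kv kL] pL pLR.
have uL : uniq ((v :: L) ++ R) by rewrite (perm_uniq pLR) mvars_uniq.
have LR y : y \in v :: L -> y \notin R.
  by rewrite (perm_mem pL) !mem_filter /= => /andP [->].
have sL : size L = n by rewrite -(size_map kind) kL size_factor.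
have inrR i : inr i \notin R by rewrite mem_filter.
exists (comm_word v L R); split; first exact: in_P_comm_word.
  move=> s [x xT sx]; case: L sL {kL pLR uL LR} pL => [e|y L _ pL]; first by move: n0; rewrite -e.
  apply: pev_comm_word0 sx; rewrite (perm_mem pL) mem_filter in_set_ord xT mem_mvars_inl /=.
  exact: ltn_ord.
pose s x : vecAs F := if x == v then (0, unit_z (pos t).1 (pos t).2)
  else if x \in R then one else (0, unit_gen (kind x)).
have sv : s v = (0, unit_z (pos t).1 (pos t).2) by rewrite /s eqxx.
have sLE x : x \in L -> s x = (0, unit_gen (kind x)).
  move=> xL; rewrite /s; case: eqP => [e|_].
    by move: uL; rewrite /= -e mem_cat xL.
  by rewrite (negbTE (LR _ _)) // inE xL orbT.
have sR x : x \in R -> s x = one.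
  move=> xR; rewrite /s xR; case: eqP => // e.
  by move: (LR v (mem_head _ _)); rewrite -e xR.
have gs : graded s.
  split=> i; rewrite /s.
    case: eqP => [e|_].
      by apply: evenA_unit_z; move: kv; rewrite -e /=; case: odd.
    by case: ifP => _; [exact: evenA_vzero|exact: evenA_unit_gen].
  case: eqP => [e|_].
    by split=> //; apply: oddA_unit_z; move: kv; rewrite -e /=; case: odd.
  by rewrite (negbTE (inrR i)); split=> //; exact: oddA_unit_gen.
exists s; split=> //.
- move=> x xT; apply: sR; have nT : ~~ in_set T (inl (val x).+1) by rewrite in_set_ord.
  by rewrite mem_filter mem_mvars_inl ltn_ord; apply/andP; split.
- move=> TT x; rewrite /s; case: eqP => // _; case: ifP => //.
  rewrite mem_filter /= => /andP [xT]; case: x xT => // i iT; rewrite mem_mvars_inl => /andP [i1 ik].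
  case/negP: iT; have hi : (i.-1 < k)%N by lia.
  by apply/existsP; exists (Ordinal hi); rewrite TT inE /= prednK.
(* The coordinate at vertex [t + n] is 1, as the parities of [L] spell the factor leading there from
   [t]. *)
rewrite (pev_comm_word sv sLE sR) => /(congr1 (fun x : vecAs F => x.2 (path_sym m w (t + n)))) /=.
rewrite (foldl_vmul_path m2) // sL leq_addl addnK kL eqxx /= !eqxx mul1r.
rewrite big_seq big1; first by move/eqP; rewrite oner_eq0.
by move=> x xL; rewrite sLE // /gen_sym /=; case: (kind x).
Qed.

Variable D : nat -> nat.
Hypothesis hD : forall k fs, indep_mod_Id (Amw_unital F m w) k l fs -> (size fs <= D k)%N.

(** There is one polynomial per set [T] of the given size. At the substitution belonging to [T0],
    any other such set has an element outside [T0]; it is replaced by 1 and kills that polynomial,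
    which isolates the coefficient of [T0]. *)
Lemma codim_unital_ge k : ('C(k, n.+1 - l) <= codim (Amw_unital F m w) k l)%N.
Proof.
pose Ts := enum [set T : {set 'I_k} | #|T| == n.+1 - l]%N.
have TsP T : T \in Ts -> #|T| = (n.+1 - l)%N by rewrite mem_enum inE => /eqP.
pose fT (T : {set 'I_k}) : npoly F := if excluded_middle_informative (#|T| = (n.+1 - l)%N) is left h
  then proj1_sig (constructive_indefinite_description _ (comm_word_witness h)) else [::].
have fTP T : T \in Ts -> [/\ in_P k l (fT T),
    forall s, (exists2 x, x \in T & s (inl (val x).+1) = one) -> pev s (fT T) = szero F &
    exists s, [/\ graded s, forall x, x \notin T -> s (inl (val x).+1) = one,
      T = setT -> forall v, (s v).1 = 0 & pev s (fT T) <> szero F]].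
  move=> /TsP cT; rewrite /fT; case: excluded_middle_informative => // h.
  by case: constructive_indefinite_description.
have <- : size (map fT Ts) = 'C(k, n.+1 - l) by rewrite size_map -cardE card_draws card_ord.
apply: (codim_ge (@hD k)); split.
  move=> f /List.in_map_iff [T [<- hT]]; suff /fTP [] : T \in Ts by [].
  by elim: Ts hT {TsP fTP} => //= U Us IH [->|/IH]; rewrite inE ?eqxx // => ->; rewrite orbT.
move=> cs scs /(has_nthP 0) [i0 hi0 ci0] hid.
have sz : size (map fT Ts) = size Ts by rewrite size_map.
rewrite scs sz in hi0.
pose T0 := nth set0 Ts i0; have T0s : T0 \in Ts by apply: mem_nth.
have [_ _ [s [gs s1 _ ne]]] := fTP T0 T0s; apply: ne.
apply: coord0 => e; apply/eqP.
have := congr1 (coord e) (hid s gs); rewrite -/(pev s _) coord_pev lin_lincomb.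
rewrite (sum_zip (n := size Ts) _ _ sz) ?scs //.
rewrite (bigD1 (Ordinal hi0)) //= big1 ?addr0.
  rewrite (nth_map set0) // -coord_pev.
  have -> : coord e (szero F) = 0 by case: (e).
  by move/eqP; rewrite mulf_eq0 (negbTE ci0).
move=> i ne; rewrite (nth_map set0) //; pose T := nth set0 Ts i.
have Ts' : T \in Ts by apply: mem_nth.
have [_ hT _] := fTP T Ts'; rewrite -coord_pev -/T hT; first by case: (e); rewrite /= /vzero mulr0.
have : ~~ (T \subset T0).
  apply: contra ne => TT0; have /eqP : T == T0 by rewrite eqEcard TT0 (TsP _ Ts') (TsP _ T0s) leqnn.
  by move/eqP; rewrite nth_uniq ?enum_uniq.
by case/subsetPn => x xT xT0; exists x => //; apply: s1.
Qed.

(** The witness for the full set takes only values of scalar part 0, so it is already nonzero on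
    A. *)
Lemma codim_Amw_ge E :
  (forall fs, indep_mod_Id (Amw F m w) (n.+1 - l) l fs -> (size fs <= E)%N) ->
  (1 <= codim (Amw F m w) (n.+1 - l) l)%N.
Proof.
move=> hE; set k := (n.+1 - l)%N.
have [|f [hf _ [s [gs _ sT ne]]]] := @comm_word_witness k setT; first by rewrite cardsT card_ord.
apply: (codim_ge hE (fs := [:: f])); split=> [g [<-|]//|[|c [|//]] // _].
rewrite /= orbF => c0 hid; apply: ne.
have sE : s = (fun v => (0, (s v).2)).
  by apply: functional_extensionality => v; move: (sT erefl v); case: (s v) => a u /= ->.
have gs' : graded_subst (B := Amw F m w) (fun v => (s v).2).
  by split=> i; [apply: gs.1|have [] := gs.2 i].
have := hid _ gs'; rewrite sE => h0; apply: coord0 => -[e|]; last by rewrite pev_aug.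
have := congr1 (fun u : vecA F => u e) h0.
have -> : poly_eval (B := Amw F m w) (fun v => (s v).2) (lincomb [:: c] [:: f]) e =
  coord (Some e) (pev (fun v => (0, (s v).2)) (lincomb [:: c] [:: f])) by rewrite pev_aug.
rewrite !coord_pev lin_lincomb big_seq1 /= => /eqP.
by rewrite mulf_eq0 (negbTE c0) => /eqP.
Qed.

End Witness.
End LowerBounds.

(** * The graded exponents *)

(** Both sides are the trinomial coefficient [n! / (l! (q - l)! (n - q)!)]. *)
Lemma bin_trinomial n q l : l <= q <= n -> 'C(n, l) * 'C(n - l, q - l) = 'C(n, q) * 'C(q, l).
Proof.
move=> /andP [lq qn].
have p : 0 < l`! * ((q - l)`! * (n - q)`!) by rewrite !muln_gt0 !fact_gt0.
apply/eqP; rewrite -(eqn_pmul2r p); apply/eqP; transitivity (n`!).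
  have h := @bin_fact (n - l) (q - l) ltac:(lia).
  have e : n - l - (q - l) = n - q by lia.
  rewrite e in h; rewrite -(bin_fact (leq_trans lq qn)) -h; lia.
have h := bin_fact lq; rewrite -(bin_fact qn) -h; lia.
Qed.

Lemma leq_bin_half n k j : 2 * k <= n.+1 -> j <= k -> 'C(n, j) <= 'C(n, k).
Proof.
move=> kn; elim: k kn => [|k IH] kn; first by rewrite leqn0 => /eqP ->.
rewrite leq_eqVlt => /orP [/eqP -> //|jk]; apply: leq_trans (IH _ jk) _; first by lia.
have e := mul_bin_left n k; rewrite -(leq_pmul2l (ltn0Sn k)) e leq_mul2r.
by apply/orP; right; lia.
Qed.

Section GradedExponent.
Variables (F : fieldType) (m : nat) (w : nat -> bool).
Hypothesis m2 : 2 <= m.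
Variables (C : nat) (Pat : nat -> seq (seq bool)).
Hypothesis size_Pat : forall n, size (Pat n) <= C * n.+1.
Hypothesis mem_Pat : forall t n, factor m w t n \in Pat n.

Notation M := (max_count m w).

Let max_bin q := 'C(q, M q).
(** Two factors [q.+1] bound the number of keys and one pays for [bin_le_max]; [C.+1] rather than
    [C] ensures positivity. *)
Let majorant q := C.+1 * (q.+1 * (q.+1 * (q.+1 * max_bin q))).
Let A := Amw F m w.
Let As := Amw_unital F m w.

Lemma max_count_le q : M q <= q.
Proof. by have := max_count_half w m2 q; lia. Qed.

(** Binomial coefficients increase up to [M q], and one step beyond they grow by a factor of at most
    [q]. *)
Lemma bin_le_max q l : l <= (M q).+1 -> 'C(q, l) <= q.+1 * max_bin q.
Proof.
rewrite /max_bin leq_eqVlt ltnS => /orP [/eqP ->|h].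
  have e := mul_bin_left q (M q); rewrite mulSn; nia.
by rewrite mulSn; apply: leq_trans (leq_bin_half (max_count_half w m2 q) h) (leq_addr _ _).
Qed.

Lemma word_bound_le q l : word_bound m w C q l * 'C(q, l) <= majorant q.
Proof.
rewrite /word_bound; case: ifP => // /bin_le_max h; rewrite /majorant.
apply: leq_trans (leq_mul (leqnn _) h) _.
have -> : q * (C * q.+1) * (q.+1 * max_bin q) = (C * q) * (q.+1 * (q.+1 * max_bin q)) by lia.
have -> : C.+1 * (q.+1 * (q.+1 * (q.+1 * max_bin q))) =
  (C.+1 * q.+1) * (q.+1 * (q.+1 * max_bin q)) by lia.
by rewrite leq_mul2r leq_mul ?orbT.
Qed.

Lemma majorant_gt0 q : 0 < majorant q.
Proof. by rewrite !muln_gt0 /= bin_gt0 max_count_le. Qed.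

Lemma codim_Amw_le k l : codim A k l <= word_bound m w C (k + l) l.
Proof.
have [psis sp hp] := Amw_tests F m2 size_Pat mem_Pat k l.
exact: leq_trans (codim_le hp) sp.
Qed.

Lemma indep_Amw_le k l fs : indep_mod_Id A k l fs -> size fs <= word_bound m w C (k + l) l.
Proof.
have [psis sp hp] := Amw_tests F m2 size_Pat mem_Pat k l.
by move=> /(indep_size_le hp) h; apply: leq_trans sp.
Qed.

Lemma codim_unital_le k l :
  codim As k l <= 1 + \sum_(T : {set 'I_k}) word_bound m w C (#|T| + l) l.
Proof.
have [psis sp hp] := Amw_unital_tests F m2 size_Pat mem_Pat k l.
exact: leq_trans (codim_le hp) sp.
Qed.

Lemma indep_unital_le k l fs : indep_mod_Id As k l fs ->
  size fs <= 1 + \sum_(T : {set 'I_k}) word_bound m w C (#|T| + l) l.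
Proof.
have [psis sp hp] := Amw_unital_tests F m2 size_Pat mem_Pat k l.
by move=> /(indep_size_le hp) h; apply: leq_trans sp.
Qed.

Lemma gr_codim_Amw_le n : gr_codim A n <= n.+1 * majorant n.
Proof.
apply: leq_trans (_ : \sum_(k < n.+1) majorant n <= _); last first.
  by rewrite sum_nat_const card_ord.
apply: leq_sum => k _; have kn : k <= n by rewrite -ltnS.
apply: leq_trans (leq_mul (leqnn _) (codim_Amw_le _ _)) _.
by rewrite subnKC // mulnC -bin_sub //; apply: word_bound_le.
Qed.

Lemma gr_codim_unital_le n :
  gr_codim As n <= n.+1 * (2 * (n.+1 * \sum_(q < n.+1) 'C(n, q) * majorant q)).
Proof.
set S := \sum_(q < n.+1) _.
have leS q : q <= n -> 'C(n, q) * majorant q <= S.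
  move=> qn; have qn' : q < n.+1 by [].
  by rewrite /S (bigD1 (Ordinal qn')) //= leq_addr.
apply: leq_trans (_ : \sum_(k < n.+1) 2 * (n.+1 * S) <= _); last first.
  by rewrite sum_nat_const card_ord.
apply: leq_sum => k _; have kn : k <= n by rewrite -ltnS.
apply: leq_trans (leq_mul (leqnn _) (codim_unital_le _ _)) _.
rewrite mulnDr muln1 mul2n -addnn leq_add //.
  apply: (@leq_trans S); last exact: leq_pmull.
  by apply: leq_trans (leS k kn); rewrite leq_pmulr ?majorant_gt0.
(* The sets [T] are grouped by cardinality [j]. *)
rewrite (partition_big (fun T : {set 'I_k} => inord #|T| : 'I_k.+1) xpredT) //= big_distrr /=.
apply: leq_trans (_ : \sum_(j < k.+1) S <= _); last first.
  by rewrite sum_nat_const card_ord leq_mul2r ltnS kn orbT.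
apply: leq_sum => j _; have jk : j <= k by rewrite -ltnS.
rewrite (eq_bigr (fun=> word_bound m w C (j + (n - k)) (n - k))); last first.
  move=> T /eqP <-; rewrite inordK // ltnS.
  by apply: leq_trans (max_card _) _; rewrite card_ord.
rewrite sum_nat_const.
have -> : #|[pred T : {set 'I_k} | inord #|T| == j]| = 'C(k, j).
  have -> : 'C(k, j) = 'C(#|'I_k|, j) by rewrite card_ord.
  rewrite -card_draws; apply: eq_card => T; rewrite !inE.
  rewrite -val_eqE /= inordK // ltnS.
  by apply: leq_trans (max_card _) _; rewrite card_ord.
(* With [l = n - k] and [q = j + l], the product ['C(n, k) * 'C(k, j)] becomes
   ['C(n, q) * 'C(q, l)]. *)
have tri := @bin_trinomial n (j + (n - k)) (n - k) ltac:(lia).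
rewrite subKn // addnK bin_sub // in tri.
rewrite mulnA tri -mulnA; apply: leq_trans (leS (j + (n - k)) ltac:(lia)).
by rewrite leq_mul2l mulnC word_bound_le orbT.
Qed.

(** A witness of degree [q] follows a factor of length [q - 1] with the most b's, and its start
    vertex may add one more odd variable; hence [l] is within one of [M q]. *)
Lemma odd_count_exists q : exists l, [/\ l <= q, M q <= l.+1, l <= (M q).+1 &
  1 < q -> 0 < codim A (q - l) l /\ forall k, 'C(k, q - l) <= codim As k l].
Proof.
case: q => [|[|n]].
(* Degrees 0 and 1 admit no commutator; only the bounds on [l] are claimed there. *)
- by exists (M 0); rewrite max_count_le.
- by exists (M 1); rewrite max_count_le.
have [t ht] := max_count_attained m w n.+1.
pose l := count id (~~ odd (path_pos m w t).1 :: factor m w t n.+1).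
have lE : l = ~~ odd (path_pos m w t).1 + M n.+1 by rewrite -ht.
have /andP [h1 h2] := max_countS w m2 n.+1.
exists l; split.
- by apply: leq_trans (count_size _ _) _; rewrite /= size_factor.
- by lia.
- by case: (odd _) lE; lia.
move=> _; split; last first.
  by apply: (codim_unital_ge m2 (ltn0Sn n) erefl (D := fun k => 1 + \sum_(T : {set 'I_k}) word_bound m w C (#|T| + l) l)) => k fs; apply: indep_unital_le.
by apply: (codim_Amw_ge m2 (ltn0Sn n) erefl (E := word_bound m w C (n.+2 - l + l) l)) => fs; apply: indep_Amw_le.
Qed.

Definition odd_count q := proj1_sig (constructive_indefinite_description _ (odd_count_exists q)).

Lemma odd_countP q : [/\ odd_count q <= q, M q <= (odd_count q).+1, odd_count q <= (M q).+1 &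
  1 < q -> 0 < codim A (q - odd_count q) (odd_count q) /\
    forall k, 'C(k, q - odd_count q) <= codim As k (odd_count q)].
Proof. by rewrite /odd_count; case: constructive_indefinite_description. Qed.

Lemma gr_codim_Amw_ge n : 1 < n -> 'C(n, odd_count n) <= gr_codim A n.
Proof.
move=> n1; have [ln _ _ /(_ n1) [h _]] := odd_countP n; set l := odd_count n in ln h *.
have kn : n - l < n.+1 by rewrite ltnS leq_subr.
rewrite /gr_codim (bigD1 (Ordinal kn)) //= subKn // bin_sub //.
by apply: leq_trans (leq_addr _ _); apply: leq_pmulr.
Qed.

Lemma bin_odd_count_le n q : 1 < q <= n -> 'C(n, q) * 'C(q, odd_count q) <= gr_codim As n.
Proof.
move=> /andP [q1 qn]; have [lq _ _ /(_ q1) [_ h]] := odd_countP q; set l := odd_count q in lq h *.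
have kn : n - l < n.+1 by rewrite ltnS leq_subr.
have ln : l <= n by apply: leq_trans qn.
rewrite /gr_codim (bigD1 (Ordinal kn)) //= subKn // bin_sub //.
apply: leq_trans (leq_addr _ _); rewrite -bin_trinomial ?lq //.
by rewrite leq_mul2l h orbT.
Qed.

Lemma gr_codim_unital_ge n : 2 < n ->
  \sum_(q < n.+1) 'C(n, q) * 'C(q, odd_count q) <= n.+1 * gr_codim As n.
Proof.
move=> n2; apply: leq_trans (_ : \sum_(q < n.+1) gr_codim As n <= _); last first.
  by rewrite sum_nat_const card_ord.
apply: leq_sum => q _; have qn : q <= n by rewrite -ltnS.
have [q1|q1] := ltnP 1 q; first by apply: bin_odd_count_le; rewrite q1.
(* The terms with [q <= 1] are at most [n], and [n <= 'C(n, 2)] for [n >= 3], so the bound at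
   [q = 2] covers them. *)
apply: (@leq_trans n); last first.
  apply: leq_trans (@bin_odd_count_le n 2 _); last by rewrite /= ltnW.
  have [l2 _ _ _] := odd_countP 2; apply: (@leq_trans 'C(n, 2)).
    by have := mul_bin_left n 1; rewrite bin1; nia.
  by rewrite leq_pmulr // bin_gt0.
have [] := odd_countP q; case: (q : nat) q1 => [|[|//]] _.
  by rewrite leqn0 => /eqP ->; rewrite !bin0; lia.
by case: (odd_count 1) => [|[|k]] h1 _ _ _; rewrite ?bin1 ?bin0 ?binn ?muln1.
Qed.

Local Open Scope R_scope.

Lemma gr_exp_unital : exists L : R, gr_exp_is A L /\ gr_exp_is As (R1 + L).
Proof.
have [beta bcv ble] := subadd_cv (max_count_sub m w).
have b1 : 0 < beta < 1.
  split; last first.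
    (* As [beta] is the infimum of the ratios, [M 3 <= 2] gives [beta <= 2 / 3]. *)
    have h : INR (M 3) <= 2 by apply: (@INR_leq _ 2); have := max_count_half w m2 3; lia.
    by have := ble 3%N isT; rewrite /=; lra.
  exact: (cv_ratio_gt0 bcv (max_count_run w m2)).
have ocv : Un_cv (fun n => INR (odd_count n) / INR n) beta.
  by apply: (cv_ratio_close bcv) => n; have [] := odd_countP n.
have up : upper_rate majorant (entropy beta).
  apply: upper_rate_mul; do 3 apply: upper_rate_S.
  exact: upper_rate_binomial max_count_le b1 bcv.
have oc_le n : (odd_count n <= n)%N by have [] := odd_countP n.
have lo := lower_rate_binomial oc_le b1 ocv.
exists (exp (entropy beta)); split.
  apply: (rates_Un_cv (n1 := 2) (upper_rate_le gr_codim_Amw_le (upper_rate_S up)) lo).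
  exact: gr_codim_Amw_ge.
have p := exp_pos (entropy beta).
rewrite -[R1 + _]exp_ln; last by lra.
(* The lower bound starts at [n = 3]; for smaller [n] the binomial sum itself is taken, so that
   [lower_rate_bin] applies at all [n]. *)
pose v n := if (2 < n)%N then gr_codim As n
  else (\sum_(q < n.+1) 'C(n, q) * 'C(q, odd_count q))%N.
apply: (rates_Un_cv (n1 := 3) (v := v)).
- apply: upper_rate_le gr_codim_unital_le _.
  by apply/upper_rate_S/upper_rate_mul/upper_rate_S/upper_rate_bin.
- apply: lower_rate_bin lo _ => n; rewrite /v; case: ifP => [|_]; first exact: gr_codim_unital_ge.
  exact: leq_pmull.
- by move=> n n3; rewrite /v n3.
Qed.

End GradedExponent.

Theorem theorem4 (F : fieldType) (charF0 : GRing.pchar F =i pred0)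
  (m : nat) (w : nat -> bool) :
  (2 <= m)%nat ->
  (sturmian w \/ periodic_word w) ->
  exists L : R,
    gr_exp_is (Amw F m w) L /\ gr_exp_is (Amw_unital F m w) (Rplus R1 L).
Proof.
move=> m2 /sturmian_or_periodic_linear [C hC].
have hF n : exists s : seq (seq bool), size s <= m.+1 * C * n.+1 /\ forall t, factor m w t n \in s.
  by have [s] := factors_linear m2 hC n; exists s.
pose Pat n := proj1_sig (constructive_indefinite_description _ (hF n)).
have PatP n : size (Pat n) <= m.+1 * C * n.+1 /\ forall t, factor m w t n \in Pat n.
  by rewrite /Pat; case: constructive_indefinite_description.
by apply: (gr_exp_unital F m2 (fun n => (PatP n).1) (fun t n => (PatP n).2 t)).
Qed.
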